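(* Let $\mathcal{S}$ be a non-degenerate thick-lined polar space of rank at least $2$ (possibly infinite) admitting an absolutely universal embedding, and let $\varepsilon:\mathcal{S}\to\mathrm{PG}(V)$ be its minimum embedding. The following are equivalent: (1) $\mathcal{S}$ is regular and, for every sub-generator $N$ of $\mathcal{S}$ such that $N^\perp$ is not a generator, there exists a sub-generator $N'$ opposite to $N$ such that $\langle N\cup N'\rangle$ is optimally embeddable; (2) every generator of $\mathcal{S}$ admits a complement.
   Context: Collinearity $\perp$ includes equality; $X^\perp$ is the set of points collinear with all points of $X$, $X^{\perp\perp}=(X^\perp)^\perp$; $\langle X\rangle$ is the subspace generated by $X$. Generators are maximal singular subspaces; a sub-generator is a singular subspace which is a hyperplane of some (equivalently every) generator containing it. Singular subspaces $X,Y$ are opposite if $X^\perp\cap Y=Y^\perp\cap X=\emptyset$; opposite points are non-collinear points. A sub-generator $N$ is $\perp$-minimal if either $N^\perp$ is a generator, or $N^\perp=\langle N\cup\{a,b\}^{\perp\perp}\rangle$ for a pair of opposite points $a,b\in N^\perp$ (for embeddable $\mathcal{S}$ this does not depend on the pair); $\mathcal{S}$ is regular if all its sub-generators are $\perp$-minimal. Embeddings are injective maps of points into points of a projective space with spanning image mapping lines onto lines; an absolutely universal embedding is one of which every embedding is a quotient; the minimum embedding is the (unique up to isomorphism) embedding that is a quotient of all embeddings. For an embedding $\varepsilon$, $\perp_\varepsilon$ is the orthogonality of the unique quasi-polarity of $\mathrm{PG}(V)$ for which all points of $\varepsilon(\mathcal{S})$ are absolute and $x\perp y\iff\varepsilon(x)\perp_\varepsilon\varepsilon(y)$;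 $Y^{\perp_\varepsilon}$ is the set of points orthogonal to all points of $Y$ ($\emptyset^{\perp_\varepsilon}=\mathrm{PG}(V)$). A subspace $X$ is optimally embeddable if for some (equivalently every) embedding $\varepsilon$ the span of $\varepsilon(X)\cup\varepsilon(X)^{\perp_\varepsilon}$ equals $\varepsilon(X\cap X^\perp)^{\perp_\varepsilon}$. Opposite generators $M,M'$ are complementary (each a complement of the other) if $\varepsilon(M)\cup\varepsilon(M')$ spans $\mathrm{PG}(V)$ for the minimum embedding $\varepsilon$. *)

(* Defs.v *)
From mathcomp Require Import all_boot all_order all_algebra.
From mathcomp Require Import classical_sets.

Set Implicit Arguments.
Unset Strict Implicit.
Unset Printing Implicit Defensive.

Import GRing.Theory.

Local Open Scope classical_set_scope.
Local Open Scope ring_scope.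

(** Point-line geometries; a line is identified with its set of points. *)

Record geometry := Geometry {
  pt : Type;
  line : set (set pt)
}.

Arguments line : clear implicits.

Section Geometry.
Variable S : geometry.
Implicit Types (x y : pt S) (X Y l : set (pt S)).

Definition collinear x y : Prop :=
  x = y \/ exists2 l, line S l & l x /\ l y.

Definition perp X : set (pt S) :=
  [set y | forall x, X x -> collinear x y].

Definition subspace X : Prop :=
  forall l, line S l ->
  forall x y, x <> y -> l x -> l y -> X x -> X y -> l `<=` X.

Definition gen X : set (pt S) :=
  \bigcap_(Y in [set Y | subspace Y /\ X `<=` Y]) Y.

(* In a projective space this is the usual notion of a hyperplane: a maximal
   proper subspace. *)
Definition hyperplane_of (H X : set (pt S)) : Prop :=
  [/\ subspace H, H `<` X &
      forall Y, subspace Y -> H `<=` Y -> Y `<=` X -> Y = H \/ Y = X].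

Definition singular X : Prop := subspace X /\ X `<=` perp X.

Definition opposite X Y : Prop :=
  perp X `&` Y = set0 /\ perp Y `&` X = set0.

Definition generator M : Prop :=
  singular M /\ forall X, singular X -> M `<=` X -> X = M.

Definition sub_generator N : Prop :=
  singular N /\ exists2 M, generator M & hyperplane_of N M.

Definition perp_minimal N : Prop :=
  generator (perp N) \/
  exists a b, [/\ perp N a, perp N b, ~ collinear a b &
                  perp N = gen (N `|` perp (perp [set a; b]))].

Definition regular_polar_space : Prop := forall N, sub_generator N -> perp_minimal N.

(* The Buekenhout-Shult one-or-all axiom. *)
Definition polar_space : Prop :=
  forall x l, line S l ->
    l `<=` perp [set x] \/ exists! y, l y /\ collinear x y.

Definition non_degenerate : Prop := perp setT = set0.

Definition thick_lined : Prop :=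
  forall l, line S l ->
  exists x y z, [/\ l x, l y & l z] /\ [/\ x <> y, y <> z & x <> z].

(* Singular subspaces of a polar space are projective spaces, and the rank of
   a projective space is the least cardinality of a generating set. *)
Definition rank_at_least (n : nat) : Prop :=
  exists2 X, singular X &
  forall (k : nat) (f : 'I_k -> pt S), (k < n)%N -> gen (range f) <> X.

End Geometry.

Arguments perp {S} X _.
Arguments gen {S} X _.

(** The projective geometry PG(V) of a left vector space V over a division
    ring K. MathComp has no structure for non-commutative division rings: that
    K is one is expressed by GRing.field_axiom, which does not involve
    commutativity. *)

Section ProjectiveSpace.
Variables (K : unitRingType) (V : lmodType K).

Record pg_point := PGPoint {
  pg_set :> set V;
  pg_setP : exists2 v, v != 0 & pg_set = range (fun a : K => a *: v)
}.

Definition pg_join (p q : pg_point) : set pg_point :=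
  [set r | pg_set r `<=` [set u + v | u in pg_set p & v in pg_set q]].

Definition PG : geometry :=
  @Geometry pg_point [set l | exists p q, p <> q /\ l = pg_join p q].

(* [R p q] reads: q lies in the image of p. *)
Definition quasi_polarity (R : pt PG -> pt PG -> Prop) : Prop :=
  (forall p q, R p q -> R q p) /\
  forall p, [set q | R p q] = setT \/ hyperplane_of [set q | R p q] setT.

Definition rel_perp (R : pt PG -> pt PG -> Prop) (Y : set (pt PG)) :
  set (pt PG) := [set q | forall p, Y p -> R p q].

End ProjectiveSpace.

Section Embeddings.
Variable S : geometry.

Record embedding := Embedding {
  emb_ring : unitRingType;
  emb_division : GRing.field_axiom emb_ring;
  emb_space : lmodType emb_ring;
  emb_fun :> pt S -> pt (PG emb_space);
  emb_inj : injective emb_fun;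
  emb_line : forall l, line S l -> line (PG emb_space) (emb_fun @` l);
  emb_span : gen (range emb_fun) = setT
}.

(* [e'] is a quotient of [e]. *)
Definition quotient_of (e e' : embedding) : Prop :=
  exists (sigma : {rmorphism emb_ring e -> emb_ring e'})
         (f : {linear emb_space e -> emb_space e' | sigma \; *:%R}),
    bijective sigma /\
    forall x, pg_set (e' x) = f @` pg_set (e x).

Definition absolutely_universal (e : embedding) : Prop :=
  forall e', quotient_of e e'.

Definition minimum_embedding (e : embedding) : Prop :=
  forall e', quotient_of e' e.

(* [R] is the orthogonality relation of [e]. For a non-degenerate thick-lined
   polar space of rank at least 2, exactly one such R exists. *)
Definition emb_orthogonality (e : embedding)
    (R : pt (PG (emb_space e)) -> pt (PG (emb_space e)) -> Prop) : Prop :=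
  [/\ quasi_polarity R,
      forall x, R (e x) (e x) &
      forall x y, collinear x y <-> R (e x) (e y)].

Definition optimally_embeddable (X : set (pt S)) : Prop :=
  exists (e : embedding) R,
    emb_orthogonality R /\
    gen (e @` X `|` rel_perp R (e @` X)) = rel_perp R (e @` (X `&` perp X)).

(* To be used with the minimum embedding [e]. *)
Definition complementary (e : embedding) (M M' : set (pt S)) : Prop :=
  [/\ generator M, generator M', opposite M M' &
      gen (e @` M `|` e @` M') = setT].

End Embeddings.

(* Main.v *)
(** Write V for the space of the minimum embedding, and H_x for the span of the
    points collinear with a point x. In any embedding a vector v + h, with v a
    singular vector not collinear with x and h in H_x, becomes singular and stays
    non-collinear with x after adding a suitable multiple of x. Hence H_x is a
    hyperplane meeting the polar space in x^perp, and the hyperplanes H_x with x on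
    a line form a pencil: a vector v in H_x and H_z but not in H_y would yield a
    point v + b y collinear with x and z but not with y. So x |-> H_x is again an
    embedding, in the dual of V over the converse ring, and V is a quotient of it.
    The resulting sesquilinear form is reflexive, because its two one-sided forms
    are proportional at every point, with the same constant at collinear points.
    This is the non-degenerate polarity of the minimum embedding.

    Given V = U + U' with U, U' the spans of a generator M and a complement M',
    a sub-generator N of M, a in M outside N and b in M' orthogonal to N, the
    orthogonal of N is spanned by N, a and b, and N' = M' /\ a^perp is as required.

    Conversely let y be a point outside M and N = M /\ y^perp. Optimality of
    <N, N'> gives V = N + N' + Z, with Z orthogonal to N and N', and minimality of
    N gives a, b in Z such that N^perp lies in the span of N, a, b. Every singular
    vector can be moved into N^perp by vectors of N' + <a> or N' + <b>, so that
    Z = <a, b>, and N' together with a or b spans a complement of M. *)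

Require Import Defs.
From HB Require Import structures.
From mathcomp Require Import all_boot all_algebra.
From mathcomp Require Import boolp classical_sets functions.

Set Implicit Arguments.
Unset Strict Implicit.
Unset Printing Implicit Defensive.

Import GRing.Theory.

Local Open Scope classical_set_scope.
Local Open Scope ring_scope.

(** * Spans and projective points *)

Section Span.
Variables (K : pzRingType) (V : lmodType K).
Implicit Types (A P : set V) (u v : V).

Definition linear_sub P : Prop :=
  P 0 /\ forall a u v, P u -> P v -> P (a *: u + v).

Section LinearSub.
Variables (P : set V) (subP : linear_sub P).

Lemma linear_subD u v : P u -> P v -> P (u + v).
Proof. by move=> Pu Pv; rewrite -(scale1r u); apply: subP.2. Qed.

Lemma linear_subZ a u : P u -> P (a *: u).
Proof. by move=> Pu; rewrite -(addr0 (a *: u)); apply: subP.2 => //; apply: subP.1. Qed.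

Lemma linear_subN u : P u -> P (- u).
Proof. by move=> Pu; rewrite -scaleN1r; apply: linear_subZ. Qed.

Lemma linear_subB u v : P u -> P v -> P (u - v).
Proof. by move=> Pu Pv; apply: linear_subD => //; apply: linear_subN. Qed.

Lemma linear_subDl u v : P u -> P (u + v) -> P v.
Proof. by move=> Pu Puv; rewrite -(addKr u v) addrC; apply: linear_subB. Qed.

End LinearSub.

Inductive lspan A : set V :=
| lspan0 : lspan A 0
| lspanS a u v : A u -> lspan A v -> lspan A (a *: u + v).

Lemma lspan_linear A : linear_sub (lspan A).
Proof.
split=> [|a u v Au Av]; first exact: lspan0.
elim: Au => [|b w u' Aw _ IH]; first by rewrite scaler0 add0r.
by rewrite scalerDr scalerA -addrA; apply: lspanS.
Qed.

Lemma lspan_gen A : A `<=` lspan A.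
Proof.
by move=> u Au; rewrite -(scale1r u) -(addr0 (1 *: u)); apply: lspanS => //; apply: lspan0.
Qed.

Lemma lspan_min A P : linear_sub P -> A `<=` P -> lspan A `<=` P.
Proof.
move=> subP AP v; elim=> [|a u w Au _ Pw]; first exact: subP.1.
by apply: subP.2 => //; apply: AP.
Qed.

Lemma lspan_mono A B : A `<=` B -> lspan A `<=` lspan B.
Proof.
move=> AB; apply: lspan_min; first exact: lspan_linear.
by move=> u /AB; apply: lspan_gen.
Qed.

Lemma linear_sub_add P Q : linear_sub P -> linear_sub Q ->
  linear_sub [set u + v | u in P & v in Q].
Proof.
move=> subP subQ; split=> [|a _ _ [u Pu [v Qv <-]] [u' Pu' [v' Qv' <-]]].
  by exists 0; [exact: subP.1 | exists 0; [exact: subQ.1 | rewrite addr0]].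
exists (a *: u + u'); first exact: subP.2.
by exists (a *: v + v'); [exact: subQ.2 | rewrite scalerDr addrACA].
Qed.

Lemma linear_sub_line v : linear_sub (range (fun a : K => a *: v)).
Proof.
split=> [|a _ _ [b _ <-] [c _ <-]]; first by exists 0; rewrite ?scale0r.
by exists (a * b + c); rewrite ?scalerDl ?scalerA.
Qed.

End Span.

Section SpanType.
Variables (K : pzRingType) (V : lmodType K) (A : set V).

Definition span_pred : {pred V} := fun v => `[< lspan A v >].

(** An embedding has to span its space, so the span of a set is made into a module of its own; the
    dual embedding takes its values in such a span. *)
Record span_type := SpanType { span_val :> V; _ : span_val \in span_pred }.

HB.instance Definition _ := [isSub for span_val].
HB.instance Definition _ := [Choice of span_type by <:].

Lemma span_closed : submod_closed span_pred.
Proof.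
split; first by apply/asboolP; apply: lspan0.
by move=> a u v /asboolP Au /asboolP Av; apply/asboolP; apply: (lspan_linear A).2.
Qed.

HB.instance Definition _ := GRing.isSubmodClosed.Build K V span_pred span_closed.
HB.instance Definition _ := [SubChoice_isSubLmodule of span_type by <:].

Lemma span_typeP (w : span_type) : lspan A w.
Proof. by case: w => w /= /asboolP. Qed.

Lemma span_valD (u v : span_type) : span_val (u + v) = span_val u + span_val v.
Proof. exact: (raddfD \val). Qed.

Lemma span_valZ a (v : span_type) : span_val (a *: v) = a *: span_val v.
Proof. exact: (linearZZ \val). Qed.

Lemma span_val0 : span_val 0 = 0.
Proof. exact: (raddf0 \val). Qed.

Definition span_in v (Av : lspan A v) : span_type := SpanType (asboolT Av).

Lemma span_type_lspan (B : set span_type) : (forall v, A v -> exists2 w, B w & span_val w = v) ->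
  forall w, lspan B w.
Proof.
move=> AB w.
suff [w' Bw' ww'] : exists2 w', lspan B w' & span_val w' = w.
  by rewrite -(val_inj ww' : w' = w).
elim: (span_typeP w) => [|a u v Au _ [w' Bw' <-]]; first by exists 0 => //; apply: lspan0.
by have [w1 Bw1 <-] := AB u Au; exists (a *: w1 + w') => //; apply: lspanS.
Qed.

End SpanType.

Section Points.
Variables (K : unitRingType) (fieldK : GRing.field_axiom K) (V : lmodType K).
Implicit Types (p q r : pg_point V) (u v w : V).

Definition rep p v : Prop := v != 0 /\ pg_set p v.

Lemma pg_inj p q : pg_set p = pg_set q -> p = q.
Proof. by case: p q => P hP [Q hQ] /= PQ; subst Q; rewrite (Prop_irrelevance hP hQ). Qed.

Lemma rep_ex p : exists v, rep p v.
Proof.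
by have [v v0 pE] := pg_setP p; exists v; split=> //; rewrite pE; exists 1; rewrite ?scale1r.
Qed.

Definition pg_of v (v0 : v != 0) : pg_point V := PGPoint (ex_intro2 _ _ v v0 erefl).

Lemma pg_of_rep v (v0 : v != 0) : rep (pg_of v0) v.
Proof. by split=> //=; exists 1; rewrite ?scale1r. Qed.

Lemma pt_ex v : v != 0 -> exists p, rep p v.
Proof. by move=> v0; exists (pg_of v0); apply: pg_of_rep. Qed.

Lemma scaleVK a v : a != 0 -> a^-1 *: (a *: v) = v.
Proof. by move=> a0; rewrite scalerA mulVr ?scale1r //; apply: fieldK. Qed.

Lemma scale_neq0 a v : a != 0 -> v != 0 -> a *: v != 0.
Proof. by move=> a0 v0; apply: contra_neq v0 => av; rewrite -(scaleVK v a0) av scaler0. Qed.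

Lemma rep_set p v : rep p v -> pg_set p = range (fun a : K => a *: v).
Proof.
have [w w0 pE] := pg_setP p; rewrite /rep pE => -[v0 [a _ /= vE]].
have a0 : a != 0 by apply: contra_neq v0 => a0; rewrite -vE a0 scale0r.
apply/seteqP; split=> _ [b _ <-].
  by exists (b * a^-1) => //; rewrite -vE -scalerA scaleVK.
by exists (b * a) => //; rewrite -vE scalerA.
Qed.

Lemma rep_inj p q v : rep p v -> rep q v -> p = q.
Proof. by move=> pv qv; apply: pg_inj; rewrite (rep_set pv) (rep_set qv). Qed.

Lemma rep_scale p v a : a != 0 -> rep p v -> rep p (a *: v).
Proof.
move=> a0 pv; split; first by apply: scale_neq0 => //; case: pv.
by rewrite (rep_set pv); exists a.
Qed.

Lemma rep_prop p u v : rep p u -> rep p v -> exists2 a, a != 0 & v = a *: u.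
Proof.
move=> pu [v0]; rewrite (rep_set pu) => -[a _ vE]; exists a => //.
by apply: contra_neq v0 => a0; rewrite -vE a0 scale0r.
Qed.

Lemma pg_linear p : linear_sub (pg_set p).
Proof. by have [v pv] := rep_ex p; rewrite (rep_set pv); apply: linear_sub_line. Qed.

Lemma pg_subset p v (P : set V) : rep p v -> linear_sub P -> P v -> pg_set p `<=` P.
Proof. by move=> /rep_set -> subP Pv _ [a _ <-]; apply: linear_subZ. Qed.

Lemma mem_pg_join p q r u v w : rep p u -> rep q v -> rep r w ->
  pg_join p q r <-> exists a b, w = a *: u + b *: v.
Proof.
move=> pu qv rw; rewrite /pg_join /= (rep_set pu) (rep_set qv); split=> [sub|[a [b wE]]].
  by have [_ [a _ <-] [_ [b _ <-] wE]] := sub _ rw.2; exists a, b.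
apply: (pg_subset rw).
  by apply: linear_sub_add; apply: linear_sub_line.
by exists (a *: u); [exists a | exists (b *: v); [exists b|]].
Qed.

(** Steinitz exchange for two vectors over a possibly noncommutative division ring. *)
Lemma span2_exchange (x y u v : V) (a b c d : K) :
  u = a *: x + b *: y -> v = c *: x + d *: y -> u != 0 ->
  ~ (exists k, v = k *: u) ->
  (exists e f, x = e *: u + f *: v) /\ (exists e f, y = e *: u + f *: v).
Proof.
(* Exchanging [x] and [y] if necessary makes [a] invertible. Then [x] is eliminated from [v], and
   the remaining coefficient [f] of [y] is nonzero because [v] is not a multiple of [u]. *)
wlog a0 : x y a b c d / a != 0 => [wl uE vE u0 uv|].
  have [a0|/(wl x y a b c d)] := eqVneq a 0; last exact.
  have b0 : b != 0 by apply: contra_neq u0 => b0; rewrite uE a0 b0 !scale0r addr0.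
  by case: (wl y x b a d c) => //; rewrite addrC.
move=> uE vE u0 uv.
have xE : x = a^-1 *: u - (a^-1 * b) *: y.
  by rewrite uE scalerDr scaleVK // scalerA addrK.
pose f := d - c * (a^-1 * b).
have vE' : v = (c * a^-1) *: u + f *: y.
  by rewrite vE xE scalerBr !scalerA /f scalerBl -addrA; congr (_ + _); rewrite addrC.
have f0 : f != 0.
  by apply: contra_notN uv => /eqP f0; exists (c * a^-1); rewrite vE' f0 scale0r addr0.
have yE : y = (- (f^-1 * (c * a^-1))) *: u + f^-1 *: v.
  by rewrite vE' scalerDr scaleVK // scalerA scaleNr addrA addNr add0r.
split; last by exists (- (f^-1 * (c * a^-1))), f^-1.
rewrite xE {1}yE scalerDr !scalerA opprD addrA -scaleNr -scalerDl -scaleNr.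
by do 2 eexists.
Qed.

(** A line is given as the join of two unnamed points; the exchange lemma replaces these by any two
    distinct points of the line. *)
Lemma PG_line_span l p q r u v w : line (PG V) l -> l p -> l q -> p <> q ->
  rep p u -> rep q v -> rep r w -> l r <-> exists a b, w = a *: u + b *: v.
Proof.
move=> [x [y [_ ->]]] lp lq pq pu qv rw.
have [s xs] := rep_ex x; have [t yt] := rep_ex y.
have [a [b uE]] := (mem_pg_join xs yt pu).1 lp.
have [c [d vE]] := (mem_pg_join xs yt qv).1 lq.
rewrite (mem_pg_join xs yt rw).
have uv : ~ exists k, v = k *: u.
  case=> k vk; apply: pq; apply: (@rep_inj _ _ v) => //.
  rewrite vk; apply: rep_scale => //; apply: contra_neq qv.1 => k0.
  by rewrite vk k0 scale0r.
have [[e [f sE]] [e' [f' tE]]] := span2_exchange uE vE pu.1 uv.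
split=> -[g [h ->]].
  rewrite sE tE !scalerDr !scalerA addrACA -!scalerDl.
  by do 2 eexists.
rewrite uE vE !scalerDr !scalerA addrACA -!scalerDl.
by do 2 eexists.
Qed.

Lemma PG_subspace_points (P : set V) : linear_sub P ->
  @subspace (PG V) [set p | pg_set p `<=` P].
Proof.
move=> subP l ll p q pq lp lq /= Pp Pq r lr /=.
have [u pu] := rep_ex p; have [v qv] := rep_ex q; have [w rw] := rep_ex r.
have [a [b wE]] := (PG_line_span ll lp lq pq pu qv rw).1 lr.
apply: (pg_subset rw) => //; rewrite wE; apply: linear_subD => //.
  by apply: linear_subZ => //; apply: Pp; apply: pu.2.
by apply: linear_subZ => //; apply: Pq; apply: qv.2.
Qed.

(** The zero vector represents no point, hence the guard [v != 0]. A sum of vectors of two distinct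
    points lies on their join; the other cases lead back to a point already at hand. *)
Lemma PG_subspace_linear (Y : set (pt (PG V))) : subspace Y ->
  linear_sub [set v | v != 0 -> exists2 p, Y p & rep p v].
Proof.
move=> subY; split=> [|a u v Yu Yv nz]; first by rewrite /= eqxx.
have [r rw] := pt_ex nz; exists r => //.
have [a0|a0] := eqVneq (a *: u) 0.
  rewrite a0 add0r in nz rw; have [p Yp pv] := Yv nz.
  by rewrite (rep_inj rw pv).
have [u0|u0] := eqVneq u 0; first by rewrite u0 scaler0 eqxx in a0.
have [p Yp pu] := Yu u0.
have [v0|v0] := eqVneq v 0.
  rewrite v0 addr0 in rw; suff -> : r = p by [].
  apply: (rep_inj rw); apply: rep_scale => //.
  by apply: contra_neq a0 => ->; rewrite scale0r.
have [q Yq qv] := Yv v0.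
have [pq|pq] := EM (p = q).
  suff -> : r = p by [].
  apply: (rep_inj rw); split=> //; rewrite -pq in qv.
  by apply: (pg_linear p).2; [case: pu | case: qv].
have ll : line (PG V) (pg_join p q) by exists p, q.
have lp : pg_join p q p by apply/(mem_pg_join pu qv pu); exists 1, 0; rewrite scale1r scale0r addr0.
have lq : pg_join p q q by apply/(mem_pg_join pu qv qv); exists 0, 1; rewrite scale1r scale0r add0r.
apply: (subY _ ll _ _ pq lp lq Yp Yq).
by apply/(mem_pg_join pu qv rw); exists a, 1; rewrite scale1r.
Qed.

Lemma subset_gen (S : geometry) (A : set (pt S)) : A `<=` gen A.
Proof. by move=> x Ax Y [_ AY]; apply: AY. Qed.

Lemma subspace_gen (S : geometry) (A : set (pt S)) : subspace (gen A).
Proof.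
move=> l ll x y xy lx ly gx gy z lz Y [subY AY].
by apply: (subY l ll x y xy lx ly) => //; [apply: gx | apply: gy].
Qed.

Lemma gen_min (S : geometry) (A Y : set (pt S)) : subspace Y -> A `<=` Y -> gen A `<=` Y.
Proof. by move=> subY AY x gx; apply: gx. Qed.

Definition vectors (A : set (pt (PG V))) : set V := [set v | exists2 p, A p & rep p v].

Lemma PG_genP (A : set (pt (PG V))) p v : rep p v -> gen A p <-> lspan (vectors A) v.
Proof.
move=> pv; split=> [gp|Av].
  suff sub : gen A `<=` [set q | pg_set q `<=` lspan (vectors A)].
    by apply: (sub p gp); case: pv.
  apply: gen_min; first by apply: PG_subspace_points; apply: lspan_linear.
  move=> q Aq; have [w qw] := rep_ex q; apply: (pg_subset qw).
    exact: lspan_linear.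
  by apply: lspan_gen; exists q.
have subL := PG_subspace_linear (@subspace_gen (PG V) A).
have AL : vectors A `<=` [set w | w != 0 -> exists2 q, gen A q & rep q w].
  by move=> w [q Aq qw] _; exists q => //; apply: subset_gen.
have [|q gq qv] := lspan_min subL AL Av; first by case: pv.
by rewrite (rep_inj pv qv).
Qed.

Lemma PG_gen_setT (A : set (pt (PG V))) :
  gen A = setT <-> forall v, lspan (vectors A) v.
Proof.
split=> [gA v|Av].
  have [->|v0] := eqVneq v 0; first exact: lspan0.
  by have [p pv] := pt_ex v0; apply/(PG_genP A pv); rewrite gA.
by apply/seteqP; split=> // p _; have [v pv] := rep_ex p; apply/(PG_genP A pv).
Qed.

End Points.

(** * Tangent hyperplanes of an embedded polar space *)

Section PolarSpaces.
Variables (S : geometry) (polarS : polar_space S) (nondegS : non_degenerate S).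
Hypothesis thickS : thick_lined S.
Hypothesis rankS : rank_at_least S 2.
Implicit Types (x y z p q r s t : pt S) (l : set (pt S)) (X Y M N : set (pt S)).

(** * Collinearity and connectedness in the polar space *)

Lemma collinear_sym x y : collinear x y -> collinear y x.
Proof. by case=> [->|[l ll [lx ly]]]; [left | right; exists l]. Qed.

Lemma line_collinear l x y : line S l -> l x -> l y -> collinear x y.
Proof. by move=> ll lx ly; right; exists l. Qed.

Lemma collinear_line x y : x <> y -> collinear x y -> exists2 l, line S l & l x /\ l y.
Proof. by move=> xy []. Qed.

Lemma foot x l : line S l -> exists2 y, l y & collinear x y.
Proof.
move=> ll; case: (polarS x ll) => [lx|[y [[ly xy] _]]]; last by exists y.
have [y [_ [_ [[ly _ _] _]]]] := thickS ll.
by exists y => //; apply: lx.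
Qed.

Lemma line_perp x l y z w : line S l -> l y -> l z -> y <> z ->
  collinear x y -> collinear x z -> l w -> collinear x w.
Proof.
move=> ll ly lz yz xy xz lw; case: (polarS x ll) => [lx|[t [_ tu]]].
  exact: (lx w lw).
by case: yz; rewrite -(tu y) // -(tu z).
Qed.

Lemma subspace_perp X : subspace (perp X).
Proof.
move=> l ll y z yz ly lz Xy Xz w lw x Xx.
exact: (line_perp ll ly lz yz (Xy x Xx) (Xz x Xx)).
Qed.

Lemma exists_far x : exists y, ~ collinear x y.
Proof.
apply: contrapT => xS; have : perp setT x; last by rewrite nondegS.
move=> y _; apply: contrapT => yx; apply: xS; exists y.
by move/collinear_sym.
Qed.

Lemma third_point l y c : line S l -> exists t, [/\ l t, t <> y & t <> c].
Proof.
move=> ll; have [a [b [d [[la lb ld] [ab bd ad]]]]] := thickS ll.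
have [ay|ay] := EM (a = y); have [ac|ac] := EM (a = c);
  have [b_y|b_y] := EM (b = y); have [bc|bc] := EM (b = c);
  try (by exists a); try (by exists b);
  by exists d; split=> // dE; subst; congruence.
Qed.

(** Without lines every set of points is a subspace and collinear points are equal, so a singular
    subspace has at most one point and is generated by fewer than two. *)
Lemma exists_line : exists l, line S l.
Proof.
have [X [subX singX] gX] := rankS.
apply: contrapT => noline.
have sub0 (Y : set (pt S)) : subspace Y by move=> l ll; case: noline; exists l.
have gen_id (Y : set (pt S)) : gen Y = Y.
  by apply/seteqP; split; [apply: gen_min | apply: subset_gen].
have [[x Xx]|X0] := EM (exists x, X x).
  apply: (gX 1%N (fun=> x)) => //; rewrite gen_id; apply/seteqP; split.
    by move=> _ [_ _ <-].
  move=> y Xy; exists ord0 => //; have := singX y Xy x Xx.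
  by case=> // -[l ll]; case: noline; exists l.
apply: (gX 0%N (fun i : 'I_0 => False_rect _ (notF (ltn_ord i)))) => //.
rewrite gen_id; apply/seteqP; split; first by move=> z [i]; have := ltn_ord i.
by move=> y Xy; case: X0; exists y.
Qed.

Lemma line_through x : exists2 l, line S l & l x.
Proof.
have [l ll] := exists_line; have [y ly xy] := foot x ll.
have [yx|yx] := EM (x = y); first by exists l; rewrite // yx.
by have [k lk [kx _]] := collinear_line yx xy; exists k.
Qed.

Lemma common_neighbour y z : exists c, collinear c y /\ collinear c z.
Proof.
have [l ll ly] := line_through y; have [c lc zc] := foot z ll.
by exists c; split; [apply: (line_collinear ll) | apply: collinear_sym].
Qed.

(** If all common neighbours of [y] and [z] were collinear with [c], then so would be all neighbours
    of [y] and all neighbours of [z]; a point not collinear with [c] refutes this. *)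
Lemma hyperbolic_perp_nondegenerate y z c : ~ collinear y z -> collinear c y -> collinear c z ->
  exists w, [/\ collinear w y, collinear w z & ~ collinear w c].
Proof.
move=> yz cy cz; apply: contrapT => nw.
have Hw w : collinear w y -> collinear w z -> collinear w c.
  by move=> wy wz; apply: contrapT => wc; apply: nw; exists w.
have claim u v : (forall w, collinear w u -> collinear w v -> collinear w c) ->
    ~ collinear u v -> collinear c u -> forall p, collinear p u -> collinear p c.
  move=> Huv uv cu p pu; have [->|p_u] := EM (p = u); first exact: collinear_sym.
  have [l ll [lp lu]] := collinear_line p_u pu.
  have [q lq vq] := foot v ll.
  have uq : u <> q by move=> uq; apply: uv; rewrite uq; apply: collinear_sym.
  apply: collinear_sym; apply: (line_perp ll lu lq uq) => //.
  apply: collinear_sym; apply: Huv; last exact: collinear_sym.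
  exact: (line_collinear ll).
have Hy := claim y z Hw yz cy.
have Hz : forall p, collinear p z -> collinear p c.
  by apply: (claim z y) => // [w wz wy|/collinear_sym //]; apply: Hw.
have [p cp] := exists_far c.
have yc : y <> c by move=> yc; apply: yz; rewrite yc.
have [m lm [my mc]] := collinear_line yc (collinear_sym cy).
have [r mr pr] := foot p lm.
have rc : r <> c by move=> rc; apply: cp; rewrite -rc; apply: collinear_sym.
have p_r : p <> r.
  by move=> p_r; apply: cp; rewrite p_r; apply: (line_collinear lm).
have [k lk [kp kr]] := collinear_line p_r pr.
have [s ks zs] := foot z lk.
(* Both [s] and [r] are collinear with [c]. If they differ, so is [p], which lies on their line; if
   they coincide, [z] is collinear with two points of the line through [y] and [c], hence with
   [y]. *)
have [sr|sr] := EM (s = r); last first.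
  apply: cp; apply: (line_perp lk ks kr sr _ _ kp).
    by apply: collinear_sym; apply: Hz; apply: collinear_sym.
  exact: (line_collinear lm).
apply: yz; apply: collinear_sym; apply: (line_perp lm mr mc rc _ _ my).
  by rewrite -sr.
exact: collinear_sym.
Qed.

(** The points not collinear with [x] are connected under collinearity, and [Q] is carried along a
    path. *)
Lemma far_connected x (Q : pt S -> Prop) :
  (forall u v, ~ collinear x u -> ~ collinear x v -> collinear u v -> Q u -> Q v) ->
  forall y z, ~ collinear x y -> ~ collinear x z -> Q y -> Q z.
Proof.
move=> step y z xy xz Qy.
have [yz|yz] := EM (collinear y z); first exact: (step y).
have via c : collinear c y -> collinear c z -> ~ collinear x c -> Q z.
  move=> cy cz xc; apply: (step c) => //; apply: (step y) => //.
  exact: collinear_sym.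
have [c [cy cz]] := common_neighbour y z.
have [xc|] := EM (collinear x c); last exact: via.
(* Here [c] is collinear with [x]. If [w] is so too, the path from [y] to [z] runs through [t] on
   the line [yc] and [s] on the line [wz]. *)
have [w [wy wz wc]] := hyperbolic_perp_nondegenerate yz cy cz.
have [xw|] := EM (collinear x w); last exact: via.
have yc : y <> c by move=> yc; apply: yz; rewrite yc.
have [l ll [ly lc]] := collinear_line yc (collinear_sym cy).
have [t [lt ty tc]] := third_point y c ll.
have xt : ~ collinear x t by move=> xt; apply: xy; apply: (line_perp ll lt lc tc).
have wt : ~ collinear w t by move=> wt; apply: wc; apply: (line_perp ll lt ly ty).
have w_z : w <> z by move=> w_z; apply: yz; apply: collinear_sym; rewrite -w_z.
have [k lk [kw kz]] := collinear_line w_z wz.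
have [s ks ts] := foot t lk.
have sw : s <> w by move=> sw; apply: wt; rewrite -sw; apply: collinear_sym.
have xs : ~ collinear x s by move=> xs; apply: xz; apply: (line_perp lk ks kw sw).
apply: (step s) => //; first exact: (line_collinear lk).
apply: (step t) => //; apply: (step y) => //; exact: (line_collinear ll).
Qed.

Section Embedded.
Variable e : embedding S.
Local Notation K := (emb_ring e).
Local Notation V := (emb_space e).
Let fieldK : GRing.field_axiom K := @emb_division S e.
Implicit Types (u v w : V) (a b : K).

Lemma emb_comb s t u v a b : collinear s t -> rep (e s) u -> rep (e t) v ->
  a *: u + b *: v != 0 ->
  exists2 r, rep (e r) (a *: u + b *: v) &
    forall X, subspace X -> X s -> X t -> X r.
Proof.
move=> st su tv w0; have [s_t|s_t] := EM (s = t).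
  exists s => //; split=> //; rewrite -s_t in tv.
  have subs := pg_linear fieldK (e s).
  by apply: linear_subD => //; apply: linear_subZ => //; [case: su | case: tv].
have [l ll [ls lt]] := collinear_line s_t st.
have [p pw] := pt_ex w0.
have est : e s <> e t by move/(@emb_inj _ e).
have [||_ ] := PG_line_span fieldK (emb_line e ll) _ _ est su tv pw.
- by exists s.
- by exists t.
case; first by exists a, b.
move=> r lr rp; exists r; first by rewrite rp.
by move=> X subX Xs Xt; apply: (subX l ll s t).
Qed.

Lemma emb_line_span l s t r u v w : line S l -> l s -> l t -> s <> t -> l r ->
  rep (e s) u -> rep (e t) v -> rep (e r) w -> exists a b, w = a *: u + b *: v.
Proof.
move=> ll ls lt s_t lr su tv rw.
have est : e s <> e t by move/(@emb_inj _ e).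
apply/(PG_line_span fieldK (emb_line e ll) _ _ est su tv rw).
- by exists s.
- by exists t.
- by exists r.
Qed.

Lemma emb_rep_inj s t v : rep (e s) v -> rep (e t) v -> s = t.
Proof. by move=> sv tv; apply: (@emb_inj _ e); apply: (rep_inj fieldK sv tv). Qed.

Lemma emb_span_lspan v : lspan (vectors (range e)) v.
Proof. by move: v; apply/(PG_gen_setT fieldK); apply: emb_span. Qed.

Lemma emb_comb_perp x s t r u v a b : collinear s t -> rep (e s) u -> rep (e t) v ->
  rep (e r) (a *: u + b *: v) -> collinear x s -> collinear x t -> collinear x r.
Proof.
move=> st su tv rw xs xt.
have [r' r'w /(_ (perp [set x]))] := emb_comb st su tv rw.1.
rewrite (emb_rep_inj r'w rw); apply=> //; first exact: subspace_perp.
  by move=> _ ->.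
by move=> _ ->.
Qed.

Definition tangent x : set V := lspan (vectors (e @` perp [set x])).

Lemma tangent_linear x : linear_sub (tangent x).
Proof. exact: lspan_linear. Qed.

Lemma collinear_tangent x y v : collinear x y -> rep (e y) v -> tangent x v.
Proof.
move=> xy yv; apply: lspan_gen; exists (e y) => //; exists y => //.
by move=> _ ->.
Qed.

Lemma addrCBK (U : zmodType) (p q r : U) : p + (q + (r - p)) = q + r.
Proof. by rewrite addrC -!addrA addNr addr0. Qed.

(* Each summand [d] of [h] can be corrected by a multiple of [u] so as to
   become collinear with [y], and is then absorbed into [y]. *)
Lemma tangent_move x u h : rep (e x) u -> tangent x h -> forall y v,
  ~ collinear x y -> rep (e y) v ->
  exists b y', ~ collinear x y' /\ rep (e y') (v + h + b *: u).
Proof.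
move=> xu; elim=> [|a d h' [_ [s xs <-] sd] _ IH] y v xy yv.
  by exists 0, y; rewrite scale0r !addr0.
have {}xs : collinear x s by apply: xs.
have [s_x|s_x] := EM (s = x).
  rewrite s_x in sd; have [k _ ->] := rep_prop fieldK xu sd.
  have [b [y' [xy' y'v]]] := IH y v xy yv.
  exists (b - a * k), y'; split=> //.
  by rewrite scalerBl scalerA -!addrA addrCBK addrA.
have [l ll [lx ls]] := collinear_line (not_eq_sym s_x) xs.
have [t lt yt] := foot y ll.
have xt : collinear x t by apply: (line_collinear ll).
have tx : t <> x by move=> tx; apply: xy; rewrite -tx; apply: collinear_sym.
have [d' td'] := rep_ex (e t).
have [c [b dE]] := emb_line_span ll lt lx tx ls td' xu sd.
have v0 : 1 *: v + (a * c) *: d' != 0.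
  apply/eqP => v0; apply: xy; suff -> : y = t by [].
  apply: (@emb_rep_inj _ _ v) => //.
  move: v0; rewrite scale1r => /(canRL (addrK _)); rewrite sub0r -scaleNr => vE.
  rewrite vE; apply: rep_scale => //.
  by apply: contra_neq yv.1 => k0; rewrite vE k0 scale0r.
have [r rv rX] := @emb_comb y t v d' 1 (a * c) yt yv td' v0.
have tr : collinear t r.
  by apply: (emb_comb_perp yt yv td' rv); [apply: collinear_sym | left].
have xr : ~ collinear x r.
  have yv' : rep (e y) (1 *: (1 *: v + (a * c) *: d') + (- (a * c)) *: d').
    by rewrite !scale1r scaleNr addrK.
  by move=> xr; apply: xy; apply: (emb_comb_perp (collinear_sym tr) rv td' yv' xr xt).
have [b' [y' [xy' y'v]]] := IH r _ xr rv.
exists (b' - a * b), y'; split=> //.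
suff -> : v + (a *: d + h') + (b' - a * b) *: u = 1 *: v + (a * c) *: d' + h' + b' *: u by [].
by rewrite dE scalerBl scalerDr !scalerA scale1r -!addrA addrCBK.
Qed.

(** Moving [y] by [- v] would leave a multiple of [u], which represents [x] itself, although the
    resulting point must not be collinear with [x]. *)
Lemma tangent_far x y v : ~ collinear x y -> rep (e y) v -> ~ tangent x v.
Proof.
move=> xy yv Hv; have [u xu] := rep_ex (e x).
have HNv : tangent x (- v) by apply: linear_subN => //; apply: tangent_linear.
have [b [y' [xy' y'v]]] := tangent_move xu HNv xy yv.
apply: xy'; rewrite subrr add0r in y'v.
suff -> : y' = x by left.
apply: (emb_rep_inj y'v); apply: rep_scale => //.
by apply: contra_neq y'v.1 => ->; rewrite scale0r.
Qed.

Lemma tangentP x y v : rep (e y) v -> tangent x v <-> collinear x y.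
Proof.
move=> yv; split=> [Hv|xy]; last exact: collinear_tangent yv.
by apply: contrapT => xy; apply: (tangent_far xy yv Hv).
Qed.

(** Modulo the tangent hyperplane, being a multiple of [v] passes from one far point to a collinear
    one, since their line contains a point collinear with [x]; and the far points are connected. *)
Lemma tangent_complement x y v : ~ collinear x y -> rep (e y) v ->
  forall w, exists k, tangent x (w - k *: v).
Proof.
move=> xy yv w; have subH := tangent_linear x.
pose P w := exists k, tangent x (w - k *: v).
apply: (@lspan_min _ _ (vectors (range e)) P) (emb_span_lspan w).
  split=> [|a u1 u2 [k1 Hk1] [k2 Hk2]].
    by exists 0; rewrite scale0r subr0; apply: subH.1.
  exists (a * k1 + k2); rewrite scalerDl opprD addrACA -scalerA -scalerBr.
  exact: subH.2.
move=> z' [_ [z _ <-] zz'].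
have [xz|xz] := EM (collinear x z).
  by exists 0; rewrite scale0r subr0; apply: collinear_tangent zz'.
suff : forall w, rep (e z) w -> P w by apply.
apply: (@far_connected x (fun z => forall w, rep (e z) w -> P w) _ y) => //;
  last first.
  move=> u' /(rep_prop fieldK yv)[k _ ->]; exists k; rewrite subrr; exact: subH.1.
move=> u t xu xt ut Qu w' tw'.
have [u_t|u_t] := EM (u = t); first by apply: Qu; rewrite u_t.
have [l ll [lu lt]] := collinear_line u_t ut.
have [s ls xs] := foot x ll.
have us : u <> s by move=> us; apply: xu; rewrite us.
have [w1 uw1] := rep_ex (e u); have [w2 sw2] := rep_ex (e s).
have [a [b w'E]] := emb_line_span ll lu ls us lt uw1 sw2 tw'.
have [k Hk] := Qu _ uw1.
exists (a * k); rewrite w'E addrAC -scalerA -scalerBr.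
apply: subH.2 => //; apply: linear_subZ => //; exact: collinear_tangent sw2.
Qed.

(** A vector that is not tangent is congruent to a nonzero multiple of a far singular vector, to
    which [tangent_move] applies. *)
Lemma tangent_or_secant x u v : rep (e x) u ->
  tangent x v \/ exists b y, ~ collinear x y /\ rep (e y) (v + b *: u).
Proof.
move=> xu; have [y xy] := exists_far x; have [w yw] := rep_ex (e y).
have [k Hk] := tangent_complement xy yw v.
have [k0|k0] := eqVneq k 0; first by left; rewrite k0 scale0r subr0 in Hk.
have [b [y' [xy' y'v]]] := tangent_move xu Hk xy (rep_scale fieldK k0 yw).
by right; exists b, y'; rewrite (addrC (k *: w)) subrK in y'v.
Qed.

Lemma tangent_functional x : exists om : V -> K,
  (forall a u v, om (a *: u + v) = a * om u + om v) /\
  (forall v, om v = 0 <-> tangent x v).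
Proof.
have [y xy] := exists_far x; have [w yw] := rep_ex (e y).
have subH := tangent_linear x.
have [om Hom] := choice (tangent_complement xy yw).
have omE v k : tangent x (v - k *: w) -> om v = k.
  move=> Hk; apply/eqP; rewrite -subr_eq0; apply: contrapT => /negP k0.
  apply: (tangent_far xy (rep_scale fieldK k0 yw)).
  have -> : (om v - k) *: w = (v - k *: w) - (v - om v *: w).
    by rewrite opprB [RHS]addrC addrA subrK scalerBl.
  exact: linear_subB.
exists om; split=> [a u v|v].
  apply: omE; rewrite scalerDl opprD addrACA -scalerA -scalerBr.
  exact: subH.2.
split=> [v0|Hv]; first by have := Hom v; rewrite v0 scale0r subr0.
by apply: omE; rewrite scale0r subr0.
Qed.

(** The hypothesis puts the tangent hyperplane at [x] inside the one at [r]. A point collinear with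
    [r] but not with [x] would then make the latter the whole space. *)
Lemma perp_antitone x r : (forall z, collinear x z -> collinear r z) ->
  forall z, collinear r z -> collinear x z.
Proof.
move=> xr z rz; apply: contrapT => xz; have [q rq] := exists_far r.
have [v zv] := rep_ex (e z); have [w qw] := rep_ex (e q).
have [k Hk] := tangent_complement xz zv w.
apply: (tangent_far rq qw); rewrite -(subrK (k *: v) w).
have subH := tangent_linear r.
apply: linear_subD => //; last by apply: linear_subZ => //; apply: collinear_tangent zv.
apply: (lspan_mono _ Hk) => t [_ [s xs <-] sp]; exists (e s) => //; exists s => //.
by move=> _ ->; apply: xr; apply: xs.
Qed.

(** Otherwise every neighbour of [x] is collinear with the whole line [xy], in particular with its
    point [r] collinear with some [p] far from [x]; by [perp_antitone], [p] would be collinear with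
    [x]. *)
Lemma perp_inj x y : (forall z, collinear x z -> collinear y z) -> x = y.
Proof.
move=> xy; apply: contrapT => x_y.
have yx : collinear y x by apply: xy; left.
have [l ll [lx ly]] := collinear_line x_y (collinear_sym yx).
have [p xp] := exists_far x; have [r lr pr] := foot p ll.
apply: xp; apply: (@perp_antitone x r); last exact: collinear_sym.
move=> z xz; apply: collinear_sym; apply: (line_perp ll lx ly x_y _ _ lr).
  exact: collinear_sym.
by apply: collinear_sym; apply: xy.
Qed.

Lemma tangent_pencil l x z y v : line S l -> l x -> l z -> x <> z -> l y ->
  tangent x v -> tangent z v -> tangent y v.
Proof.
move=> ll lx lz xz ly Hx Hz; have [u yu] := rep_ex (e y).
have [//|[b [p [yp pv]]]] := tangent_or_secant v yu.
case: yp; apply: collinear_sym; apply: (line_perp ll lx lz xz _ _ ly).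
  apply: collinear_sym; apply/(tangentP _ pv); apply: linear_subD => //.
    exact: tangent_linear.
  apply: linear_subZ; first exact: tangent_linear.
  by apply: collinear_tangent yu; apply: (line_collinear ll).
apply: collinear_sym; apply/(tangentP _ pv); apply: linear_subD => //.
  exact: tangent_linear.
apply: linear_subZ; first exact: tangent_linear.
by apply: collinear_tangent yu; apply: (line_collinear ll).
Qed.

End Embedded.

(** * The dual embedding *)

Section Dual.
Variable e : embedding S.
Local Notation K := (emb_ring e).
Local Notation V := (emb_space e).
Let fieldK : GRing.field_axiom K := @emb_division S e.
Implicit Types (u v w : V) (a b : K).

Definition tangent_form x : V -> K := sval (cid (@tangent_functional e x)).

Lemma tangent_form_linear x a u v :
  tangent_form x (a *: u + v) = a * tangent_form x u + tangent_form x v.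
Proof. by rewrite /tangent_form; case: cid => f /= [+ _]; apply. Qed.

Lemma tangent_form_eq0 x v : tangent_form x v = 0 <-> tangent x v.
Proof. by rewrite /tangent_form; case: cid => f /= [_]; apply. Qed.

Lemma tangent_form_rep x y v : rep (e y) v -> tangent_form x v = 0 <-> collinear x y.
Proof.
move=> yv; split=> [/tangent_form_eq0/(tangentP x yv)//|xy].
by apply/tangent_form_eq0/(tangentP x yv).
Qed.

Lemma tangent_form_neq0 x y v : rep (e y) v -> ~ collinear x y -> tangent_form x v != 0.
Proof. by move=> yv xy; apply/eqP => /(tangent_form_rep x yv). Qed.

(** By [perp_inj], each of the two points has a neighbour that is not collinear with the other. *)
Lemma tangent_form_dual_basis x y : x <> y -> exists p q : V,
  [/\ tangent_form x p = 0, tangent_form y p != 0, tangent_form x q != 0 & tangent_form y q = 0].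
Proof.
have sep s t : s <> t -> exists2 p : V, tangent_form s p = 0 & tangent_form t p != 0.
  move=> st; apply: contrapT => np; apply: st; apply: (@perp_inj e _ _) => z sz.
  have [p zp] := rep_ex (e z).
  apply: contrapT => tz; apply: np; exists p; first exact/(tangent_form_rep s zp).
  exact: tangent_form_neq0 zp tz.
move=> xy; have [p xp yp] := sep x y xy; have [q yq xq] := sep y x (not_eq_sym xy).
by exists p, q.
Qed.

(** Suitable multiples of [q] and [p] move [v] into the tangent hyperplanes at [x] and [y], hence
    into that at [z] by [tangent_pencil]; this determines the form at [z]. *)
Lemma tangent_form_line l x y z : line S l -> l x -> l y -> x <> y -> l z ->
  exists a b, forall v, tangent_form z v = tangent_form x v * a + tangent_form y v * b.
Proof.
move=> ll lx ly xy lz; have [p [q [xp yp xq yq]]] := tangent_form_dual_basis xy.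
exists ((tangent_form x q)^-1 * tangent_form z q), ((tangent_form y p)^-1 * tangent_form z p) => v.
pose al := - (tangent_form x v * (tangent_form x q)^-1).
pose be := - (tangent_form y v * (tangent_form y p)^-1).
have : tangent_form z (al *: q + (be *: p + v)) = 0.
  apply/tangent_form_eq0; apply: (tangent_pencil (x := x) (z := y) ll) => //;
    apply/tangent_form_eq0.
    by rewrite !tangent_form_linear xp mulr0 add0r mulNr divrK ?addNr //; apply: fieldK.
  by rewrite !tangent_form_linear yq mulr0 add0r mulNr divrK ?addNr //; apply: fieldK.
rewrite !tangent_form_linear !mulNr -!mulrA => h.
move/(canRL (addNKr _)): h; rewrite addr0 => /(canRL (addNKr _)) ->.
by rewrite addrC.
Qed.

Lemma tangent_form_line_onto l x y a b v0 : line S l -> l x -> l y -> x <> y ->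
  tangent_form x v0 * a + tangent_form y v0 * b != 0 ->
  exists z k, l z /\ forall v, tangent_form x v * a + tangent_form y v * b = tangent_form z v * k.
Proof.
move=> ll lx ly xy nz.
have [a0|a0] := eqVneq a 0.
  by exists y, b; split=> // v; rewrite a0 mulr0 add0r.
have [p [q [xp yp xq yq]]] := tangent_form_dual_basis xy.
have Ua := fieldK a0; have Uxq := fieldK xq; have Uyp := fieldK yp.
(* The vector [v] is chosen in the kernel of the given combination but outside the tangent
   hyperplane at [y]. *)
pose al := - (tangent_form y p * b / a / tangent_form x q).
pose v := al *: q + p.
have xv : tangent_form x v = - (tangent_form y p * b / a)
  by rewrite tangent_form_linear xp addr0 mulNr divrK.
have yv : tangent_form y v = tangent_form y p by rewrite tangent_form_linear yq mulr0 add0r.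
have [u yu] := rep_ex (e y).
case: (tangent_or_secant v yu) => [/tangent_form_eq0|[c [t [_ tv]]]].
  by rewrite yv => /eqP; rewrite (negbTE yp).
(* The second singular point [t] on the line joining [v] and [y] selects [z]: the form at [z] kills
   [t] and [y], hence [v], so it is proportional to the given combination. *)
have [z lz tz] := foot t ll; have zt := collinear_sym tz.
have [a' [b' zE]] := tangent_form_line ll lx ly xy lz.
have : tangent_form z (c *: u + v) = 0 by rewrite addrC; apply/(tangent_form_rep z tv).
have -> : tangent_form z (c *: u + v) = tangent_form z v.
  by rewrite tangent_form_linear (_ : tangent_form z u = 0) ?mulr0 ?add0r //;
    apply/(tangent_form_rep z yu);
    apply: (line_collinear ll).
rewrite zE xv yv mulNr => /eqP; rewrite addrC subr_eq0 -!mulrA => /eqP.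
move=> /(can_inj (mulKr Uyp)) b'E.
have a'0 : a' != 0.
  apply/eqP => a'0; have [r zr] := exists_far z; have [d rd] := rep_ex (e r).
  by case/eqP: (tangent_form_neq0 rd zr); rewrite zE b'E a'0 !mulr0 addr0.
exists z, (a'^-1 * a); split=> // v1.
have Ua' := fieldK a'0.
by rewrite zE b'E mulrDl -!mulrA mulVKr // mulVr // mulr1.
Qed.

(** Left-linear forms are scaled on the right, which makes them a left module over the converse ring
    [K^c]. Only the span of the tangent forms is taken, so that the dual map has spanning image. *)
Definition dual_space := span_type (range tangent_form : set (V -> (K^c)^o)).
Implicit Types f g : dual_space.
Definition ev f v : K := span_val f v.

Lemma evD f g v : ev (f + g) v = ev f v + ev g v.
Proof. by rewrite /ev span_valD. Qed.
Lemma evZ a f v : ev ((a : K^c) *: f) v = ev f v * a.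
Proof. by rewrite /ev span_valZ. Qed.
Lemma ev0 v : ev 0 v = 0.
Proof. by rewrite /ev span_val0. Qed.

Lemma ev_inj f g : (forall v, ev f v = ev g v) -> f = g.
Proof. by move=> fg; apply: val_inj; apply/funext. Qed.

Lemma ev_linear f a u v : ev f (a *: u + v) = a * ev f u + ev f v.
Proof.
rewrite /ev; elim: (span_typeP f) => [|c _ g [x _ <-] _ IH].
  by rewrite mulr0 addr0.
have E w : (c *: (tangent_form x : V -> (K^c)^o) + g) w = tangent_form x w * c + g w by [].
by rewrite !E IH tangent_form_linear mulrDl mulrDr addrACA mulrA.
Qed.

Lemma evDr f u v : ev f (u + v) = ev f u + ev f v.
Proof. by rewrite -{1}(scale1r u) ev_linear mul1r. Qed.

Lemma ev0r f : ev f 0 = 0.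
Proof. by apply: (addrI (ev f 0)); rewrite -evDr !addr0. Qed.

Definition dual_form x : dual_space := span_in (lspan_gen (ex_intro2 _ _ x I erefl)).

Lemma ev_dual_form x v : ev (dual_form x) v = tangent_form x v. Proof. by []. Qed.

Lemma dual_form_neq0 x : dual_form x != 0.
Proof.
apply/eqP => x0; have [r xr] := exists_far x; have [d rd] := rep_ex (e r).
by case/eqP: (tangent_form_neq0 rd xr); rewrite -ev_dual_form x0.
Qed.

Definition dual_pt x : pg_point dual_space := pg_of (dual_form_neq0 x).

Lemma fieldKc : GRing.field_axiom K^c. Proof. exact: fieldK. Qed.

Lemma dual_pt_rep x : rep (dual_pt x) (dual_form x).
Proof. exact: pg_of_rep. Qed.

Lemma dual_inj : injective dual_pt.
Proof.
move=> x y xy; apply: (@perp_inj e _ _) => z xz.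
have yx : rep (dual_pt x) (dual_form y) by rewrite xy; apply: dual_pt_rep.
have [k _ kE] := rep_prop fieldKc (dual_pt_rep x) yx.
have [d zd] := rep_ex (e z).
by apply/(tangent_form_rep y zd);
  rewrite -ev_dual_form kE evZ ev_dual_form ((tangent_form_rep x zd).2 xz) mul0r.
Qed.

Lemma dual_line l : line S l -> line (PG dual_space) (dual_pt @` l).
Proof.
move=> ll; have [x [y [_ [[lx ly _] [xy _ _]]]]] := thickS ll.
exists (dual_pt x), (dual_pt y); split; first by move/dual_inj.
apply/seteqP; split=> [_ [z lz <-]|r].
  apply/(mem_pg_join fieldKc (dual_pt_rep x) (dual_pt_rep y) (dual_pt_rep z)).
  have [a [b zE]] := tangent_form_line ll lx ly xy lz.
  by exists a, b; apply: ev_inj => v; rewrite evD !evZ !ev_dual_form.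
have [w rw] := rep_ex r.
move/(mem_pg_join fieldKc (dual_pt_rep x) (dual_pt_rep y) rw) => [a [b wE]].
have [v0 nz] : exists v0, ev w v0 != 0.
  apply: contrapT => w0; case/eqP: rw.1; apply: ev_inj => v; rewrite ev0.
  by apply: contrapT => /eqP wv; apply: w0; exists v.
have [|z [k [lz zE]]] := @tangent_form_line_onto l x y a b v0 ll lx ly xy.
  by rewrite wE evD !evZ in nz.
have wk : w = (k : K^c) *: dual_form z.
  by apply: ev_inj => v; rewrite evZ ev_dual_form -zE wE evD !evZ.
exists z => //; apply: (rep_inj fieldKc (v := w)) => //; rewrite wk.
apply: rep_scale; [exact: fieldKc | | exact: dual_pt_rep].
by apply: contra_neq rw.1 => k0; rewrite wk k0 scale0r.
Qed.

Lemma dual_lspan f : lspan (vectors (range dual_pt)) f.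
Proof.
apply: span_type_lspan => _ [x _ <-]; exists (dual_form x) => //.
by exists (dual_pt x); [exists x | apply: dual_pt_rep].
Qed.

Lemma dual_span : gen (range dual_pt : set (pt (PG dual_space))) = setT.
Proof. by apply/(PG_gen_setT fieldKc); apply: dual_lspan. Qed.

Definition dual : embedding S := Embedding fieldKc dual_inj dual_line dual_span.

End Dual.

(** * The polarity of the minimum embedding *)

Section Polarity.
Variables (e : embedding S) (min_e : minimum_embedding e).
Local Notation K := (emb_ring e).
Local Notation V := (emb_space e).
Local Notation W := (dual_space e).
Let fieldK : GRing.field_axiom K := @emb_division S e.
Implicit Types (u v : V) (w : W) (a b c : K).

(** The dual embedding lives over the converse ring, so the ring morphism of the quotient becomes an
    anti-automorphism [s] of [K]. *)
Lemma dual_quotient : exists (s : K -> K) (f : W -> V),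
  [/\ bijective s, zmod_morphism s, s 1 = 1 /\ forall a b, s (a * b) = s b * s a,
      forall a w w', f ((a : K^c) *: w + w') = s a *: f w + f w' &
      forall x, pg_set (e x) = f @` pg_set (dual_pt e x)].
Proof.
have [s [f [bs fE]]] := min_e (dual e).
exists s, f; split=> //.
- exact: (rmorphB s).
- by split=> [|a b]; [apply: (rmorph1 s) | apply: (rmorphM s (b : K^c) a)].
- by move=> a w w'; apply: (linearP f a w w').
Qed.

Section Reflexive.
Variables (s : K -> K) (f : W -> V).
Hypotheses (sK : bijective s) (sB : zmod_morphism s).
Hypotheses (s1 : s 1 = 1) (sM : forall a b, s (a * b) = s b * s a).
Hypothesis (fP : forall a w w', f ((a : K^c) *: w + w') = s a *: f w + f w').
Hypothesis (f_pt : forall x, pg_set (e x) = f @` pg_set (dual_pt e x)).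

Lemma semi0 : s 0 = 0. Proof. by rewrite -[X in s X](subrr 0) sB subrr. Qed.
Lemma semiD a b : s (a + b) = s a + s b.
Proof. by have := sB (a + b) b; rewrite addrK => ->; rewrite subrK. Qed.
Lemma semi_eq0 a : s a = 0 -> a = 0.
Proof. by move=> sa; apply: (bij_inj sK); rewrite sa semi0. Qed.

Lemma transferD w w' : f (w + w') = f w + f w'.
Proof. by rewrite -{1}(scale1r w) fP s1 scale1r. Qed.

Lemma transfer0 : f 0 = 0.
Proof. by apply: (addrI (f 0)); rewrite -transferD !addr0. Qed.

Lemma transferZ a w : f ((a : K^c) *: w) = s a *: f w.
Proof. by rewrite -(addr0 (_ *: w)) fP transfer0 addr0. Qed.

Lemma transfer_rep x w : rep (dual_pt e x) w -> rep (e x) (f w).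
Proof.
move=> xw; split; last by rewrite f_pt; exists w => //; case: xw.
have [v [v0]] := rep_ex (e x).
rewrite f_pt (rep_set (@fieldKc e) xw) => -[_ [a _ <-]] fE.
by apply: contra_neq v0 => fw; rewrite -fE transferZ fw scaler0.
Qed.

Lemma ev_perp x y w v : collinear x y -> rep (dual_pt e x) w -> rep (e y) v -> ev w v = 0.
Proof.
move=> xy xw yv; have [a _ ->] := rep_prop (@fieldKc e) (dual_pt_rep e x) xw.
by rewrite evZ ev_dual_form (tangent_form_rep x yv).2 // mul0r.
Qed.

Lemma ev_far x y w v : ~ collinear x y -> rep (dual_pt e x) w -> rep (e y) v -> ev w v != 0.
Proof.
move=> xy xw yv; have [a a0 ->] := rep_prop (@fieldKc e) (dual_pt_rep e x) xw.
apply/eqP; rewrite evZ => /(canRL (mulrK (fieldK a0))); rewrite mul0r ev_dual_form.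
by apply/eqP; apply: tangent_form_neq0 yv xy.
Qed.

(** The dual is itself an embedding and has tangent hyperplanes of its own. These are spanned by
    forms at points collinear with [x], on which both one-sided forms vanish. *)
Lemma ev_tangent x w h : rep (dual_pt e x) w -> tangent (e := dual e) x h ->
  ev w (f h) = 0 /\ ev h (f w) = 0.
Proof.
move=> xw; apply: (lspan_min (P := fun h => ev w (f h) = 0 /\ ev h (f w) = 0)).
  split=> [|a h1 h2 [p1 q1] [p2 q2]]; first by rewrite transfer0 ev0 ev0r.
  by rewrite fP ev_linear evD evZ p1 p2 q1 q2 mulr0 mul0r addr0.
move=> h' [_ [y xy <-] yh]; have {}xy : collinear x y by apply: xy.
split; first exact: (ev_perp xy xw (transfer_rep yh)).
exact: (ev_perp (collinear_sym xy) yh (transfer_rep xw)).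
Qed.

(** For fixed [w] both sides are semilinear in [w'] with respect to [s], so the constant stands on
    the right. *)
Definition proportional w c : Prop := forall w', s (ev w' (f w)) = ev w (f w') * c.

(** Both functionals vanish on the tangent hyperplane of the dual at [x], so their ratio is read off
    at a single far [g]. *)
Lemma proportional_exists x w : rep (dual_pt e x) w -> exists c, proportional w c.
Proof.
move=> xw; have [y xy] := exists_far x; have [g yg] := rep_ex (dual_pt e y).
have nz := fieldK (ev_far xy xw (transfer_rep yg)).
exists ((ev w (f g))^-1 * s (ev g (f w))) => w'.
have [k /(ev_tangent xw)[]] := tangent_complement (e := dual e) xy yg w'.
set h := w' - _ => h1 h2.
have -> : w' = (k : K^c) *: g + h by rewrite /h addrC subrK.
rewrite evD evZ fP ev_linear h1 h2 !addr0 sM -mulrA; congr (_ * _).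
by rewrite mulVKr.
Qed.

(** The sum [w1 + w2] represents a point of the line and has a constant [c]. Testing at a point
    collinear with one of [x], [y] but not with the other isolates [c1 = c], and likewise
    [c2 = c]. *)
Lemma proportional_line x y w1 w2 c1 c2 : collinear x y -> x <> y ->
  rep (dual_pt e x) w1 -> rep (dual_pt e y) w2 ->
  proportional w1 c1 -> proportional w2 c2 -> c1 = c2.
Proof.
move=> xy x_y xw1 yw2 cw1 cw2.
have nz : (1 : K^c) *: w1 + (1 : K^c) *: w2 != 0.
  apply/eqP; rewrite !scale1r => /(canRL (addrK _)); rewrite sub0r => w1E; apply: x_y.
  apply: (emb_rep_inj (e := dual e) (v := w1)) => //; rewrite w1E -scaleN1r.
  by apply: (rep_scale (@fieldKc e)) => //; rewrite oppr_eq0 oner_eq0.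
have [r rw _] := emb_comb (e := dual e) xy xw1 yw2 nz.
have [c cw] := proportional_exists rw.
have sum w' : ev w1 (f w') * c1 + ev w2 (f w') * c2 = (ev w1 (f w') + ev w2 (f w')) * c.
  by have := cw w'; rewrite !scale1r transferD evDr -cw1 -cw2 semiD evD.
have pick p q (u1 u2 : W) d1 d2 : p <> q -> rep (dual_pt e p) u1 -> rep (dual_pt e q) u2 ->
    (forall w', ev u1 (f w') * d1 + ev u2 (f w') * d2 = (ev u1 (f w') + ev u2 (f w')) * c) ->
    d1 = c.
  move=> pq pu qu sumE.
  have [z qz pz] : exists2 z, collinear q z & ~ collinear p z.
    apply: contrapT => nz'; apply: pq; apply: esym; apply: (@perp_inj e _ _) => z qz.
    by apply: contrapT => pz; apply: nz'; exists z.
  have [g zg] := rep_ex (dual_pt e z).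
  have := sumE g; rewrite (ev_perp qz qu (transfer_rep zg)) mul0r !addr0.
  by apply: mulrI; apply: fieldK; apply: (ev_far pz pu (transfer_rep zg)).
have -> : c1 = c by apply: (pick x y w1 w2 c1 c2).
apply: esym; apply: (pick y x w2 w1 c2 c1) => //; first exact: not_eq_sym.
by move=> w'; rewrite addrC sum addrC.
Qed.

(** Two points have a common neighbour distinct from both, found on a line through them if they are
    collinear; [proportional_line] is then applied twice. *)
Lemma proportional_points x y w1 w2 c1 c2 :
  rep (dual_pt e x) w1 -> rep (dual_pt e y) w2 ->
  proportional w1 c1 -> proportional w2 c2 -> c1 = c2.
Proof.
move=> xw1 yw2 cw1 cw2.
have [z [xz yz zx zy]] : exists z, [/\ collinear x z, collinear y z, z <> x & z <> y].
  have [xy|xy] := EM (collinear x y); last first.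
    have [z [zx zy]] := common_neighbour x y.
    exists z; split; try exact: collinear_sym.
      by move=> zE; apply: xy; rewrite -zE.
    by move=> zE; apply: xy; rewrite -zE; apply: collinear_sym.
  have [x_y|x_y] := EM (x = y).
    have [l ll lx] := line_through x; have [t [lt tx _]] := third_point x x ll.
    by exists t; rewrite -x_y; split=> //; apply: (line_collinear ll).
  have [l ll [lx ly]] := collinear_line x_y xy.
  have [t [lt tx ty]] := third_point x y ll.
  by exists t; split=> //; apply: (line_collinear ll).
have [g zg] := rep_ex (dual_pt e z); have [c cg] := proportional_exists zg.
rewrite (proportional_line xz (not_eq_sym zx) xw1 zg cw1 cg).
by rewrite (proportional_line yz (not_eq_sym zy) yw2 zg cw2 cg).
Qed.

(** The forms at points share one constant and span the dual, and proportionality with a fixed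
    constant is additive. *)
Lemma proportional_all : exists c, forall w, proportional w c.
Proof.
have [l ll] := exists_line; have [x [_ [_ [_ _]]]] := thickS ll.
have [g xg] := rep_ex (dual_pt e x); have [c cg] := proportional_exists xg.
exists c => w; elim: (dual_lspan w) => [|a w1 w2 [_ [y _ <-] yw1] _ IH] w'.
  by rewrite transfer0 ev0r ev0 semi0 mul0r.
have [a0|a0] := eqVneq a 0; first by rewrite a0 scale0r add0r; apply: IH.
have yaw : rep (dual_pt e y) (a *: w1) by apply: (rep_scale (@fieldKc e)).
have [c' cw'] := proportional_exists yaw.
have c'E := proportional_points yaw xg cw' cg; rewrite {}c'E in cw'.
by rewrite transferD evDr evD mulrDl semiD cw' IH.
Qed.

Lemma ev_reflexive w w' : ev w (f w') = 0 -> ev w' (f w) = 0.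
Proof.
have [c cP] := proportional_all.
by move=> ww'; apply: semi_eq0; rewrite cP ww' mul0r.
Qed.

Lemma transfer_surj v : exists w, f w = v.
Proof.
have [s' s'K ss'] := sK.
elim: (emb_span_lspan (e := e) v) => [|a u v' [_ [x _ <-] [_ xu]] _ [w wv']].
  by exists 0; apply: transfer0.
move: xu; rewrite f_pt => -[w1 _ w1u].
by exists ((s' a : K^c) *: w1 + w); rewrite fP ss' w1u wv'.
Qed.

(** If [f] kills [k], reflexivity makes the form [k] vanish on the image of [f], which is the whole
    space. *)
Lemma transfer_inj : injective f.
Proof.
move=> w w' ww'; apply/eqP; rewrite -subr_eq0; apply/eqP.
set k := w - w'.
have fk : f k = 0 by apply: (addIr (f w')); rewrite -transferD subrK add0r.
apply: ev_inj => v; have [g <-] := transfer_surj v.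
by rewrite ev0; apply: ev_reflexive; rewrite fk ev0r.
Qed.

End Reflexive.

(** Only the orthogonality relation of the form is kept, so that the anti-automorphism does not
    enter the later arguments. *)
Record orthogonality (orth : V -> V -> Prop) : Prop := Orthogonality {
  orth_linear : forall u, linear_sub (orth u);
  orth_sym : forall u v, orth u v -> orth v u;
  orth_codim1 : forall u v v', ~ orth u v -> exists k, orth u (v' - k *: v);
  orth_nondegenerate : forall u, (forall v, orth u v) -> u = 0;
  orth_collinear : forall x y u v, rep (e x) u -> rep (e y) v -> orth u v <-> collinear x y
}.

(** As [f] is bijective, the pairing of the dual with [V] becomes a form on [V]; it is nondegenerate
    because an element of the dual is determined by its values. *)
Lemma exists_orthogonality : exists orth, orthogonality orth.
Proof.
have [s [f [sK sB [s1 sM] fP f_pt]]] := dual_quotient.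
have fI := transfer_inj sK sB s1 sM fP f_pt.
have [g fg] := choice (transfer_surj sK s1 fP f_pt).
have gf : cancel f g by move=> w; apply: fI; rewrite fg.
exists (fun u v => ev (g u) v = 0); split.
- move=> u; split; first exact: ev0r.
  by move=> a v v' h h'; rewrite ev_linear h h' mulr0 addr0.
- by move=> u v; rewrite -{1}(fg v); move/(ev_reflexive sK sB s1 sM fP f_pt); rewrite fg.
- move=> u v v' /eqP/fieldK Uv; exists (ev (g u) v' / ev (g u) v).
  by rewrite addrC -scaleNr ev_linear mulNr divrK // addNr.
- move=> u h; rewrite -(fg u); have -> : g u = 0 by apply: ev_inj.
  exact: (transfer0 s1 fP).
move=> x y u v xu yv; have [w xw] := rep_ex (dual_pt e x).
have xfw := transfer_rep s1 fP f_pt xw.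
have [a a0 uE] := rep_prop fieldK xfw xu.
have [s' s'K ss'] := sK.
have xgu : rep (dual_pt e x) (g u).
  have -> : g u = (s' a : K^c) *: w.
    by apply: fI; rewrite fg uE (transferZ s1 fP) ss'.
  apply: (rep_scale (@fieldKc e)) => //.
  by apply: contra_neq a0 => a0; rewrite -(ss' a) a0 (semi0 sB).
split=> [h|xy]; last exact: ev_perp xy xgu yv.
by apply: contrapT => xy; have := ev_far xy xgu yv; rewrite h eqxx.
Qed.

End Polarity.

(** * Singular vectors *)

Section Orthogonality.
Variables (e : embedding S) (orth : emb_space e -> emb_space e -> Prop).
Hypothesis orthP : orthogonality orth.
Local Notation K := (emb_ring e).
Local Notation V := (emb_space e).
Let fieldK : GRing.field_axiom K := @emb_division S e.
Implicit Types (u v w : V) (a b c k : K) (P : set V).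

Definition cone X : set V := [set v | v = 0 \/ exists2 s, X s & rep (e s) v].

Lemma cone_rep X s v : X s -> rep (e s) v -> cone X v.
Proof. by move=> Xs sv; right; exists s. Qed.

Lemma emb_comb_mem X s t r u v a b : subspace X -> X s -> X t -> collinear s t ->
  rep (e s) u -> rep (e t) v -> rep (e r) (a *: u + b *: v) -> X r.
Proof.
move=> subX Xs Xt st su tv rw; have [r' r'w] := emb_comb st su tv rw.1.
by rewrite (emb_rep_inj r'w rw); apply.
Qed.

Lemma cone_linear X : singular X -> linear_sub (cone X).
Proof.
move=> [subX singX]; split=> [|a u v]; first by left.
case=> [->|[s Xs su]]; first by rewrite scaler0 add0r.
case=> [->|[t Xt tv]].
  rewrite addr0; have [->|a0] := eqVneq a 0; first by left; rewrite scale0r.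
  by right; exists s => //; apply: rep_scale.
have [w0|w0] := eqVneq (a *: u + 1 *: v) 0; first by left; rewrite scale1r in w0.
have [r rw rX] := emb_comb (singX t Xt s Xs) su tv w0.
by right; exists r; [apply: rX | rewrite scale1r in rw].
Qed.

Lemma cone_lspan X (A : set (pt (PG V))) v : e @` X `<=` A -> cone X v -> lspan (vectors A) v.
Proof.
move=> XA [->|[s Xs sv]]; first exact: lspan0.
by apply: lspan_gen; exists (e s) => //; apply: XA; exists s.
Qed.

Lemma orth_cone X s v w : (forall t, X t -> collinear s t) -> rep (e s) v -> cone X w -> orth v w.
Proof.
move=> sX sv [->|[t Xt tw]]; first exact: (orth_linear orthP v).1.
by apply/(orth_collinear orthP sv tw); apply: sX.
Qed.

Lemma orth_cones X Y v w : (forall s t, X s -> Y t -> collinear s t) ->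
  cone X v -> cone Y w -> orth v w.
Proof.
move=> XY [->|[s Xs sv]] Yw.
  by apply: (orth_sym orthP); apply: (orth_linear orthP w).1.
by apply: (orth_cone _ sv Yw) => t; apply: XY.
Qed.

Definition pts P : set (pt S) := [set s | pg_set (e s) `<=` P].

Lemma pts_rep P s v : linear_sub P -> rep (e s) v -> pts P s <-> P v.
Proof.
move=> subP sv; split=> [|Pv]; first by apply; case: sv.
exact: pg_subset Pv.
Qed.

Lemma pts_subspace P : linear_sub P -> subspace (pts P).
Proof.
move=> subP l ll x y xy lx ly Px Py z lz.
have [u xu] := rep_ex (e x); have [v yv] := rep_ex (e y); have [w zw] := rep_ex (e z).
have [a [b wE]] := emb_line_span ll lx ly xy lz xu yv zw.
apply/(pts_rep subP zw); rewrite wE; apply: subP.2; first exact/(pts_rep subP xu).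
by apply: linear_subZ => //; apply/(pts_rep subP yv).
Qed.

Lemma pts_singular P : linear_sub P -> (forall u v, P u -> P v -> orth u v) ->
  singular (pts P).
Proof.
move=> subP isoP; split; first exact: pts_subspace.
move=> s Ps t Pt; have [u su] := rep_ex (e s); have [v tv] := rep_ex (e t).
by apply/(orth_collinear orthP tv su); apply: isoP;
  [exact/(pts_rep subP tv)|exact/(pts_rep subP su)].
Qed.

Definition adjoin P v : set V := [set u + w | u in P & w in range (fun k => k *: v)].

Lemma adjoin_linear P v : linear_sub P -> linear_sub (adjoin P v).
Proof. by move=> subP; apply: linear_sub_add => //; apply: linear_sub_line. Qed.

Lemma adjoin_sub P v : P `<=` adjoin P v.
Proof. by move=> u Pu; exists u => //; exists 0; [exists 0; rewrite ?scale0r | rewrite addr0]. Qed.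

Lemma adjoin_mem P v : linear_sub P -> adjoin P v v.
Proof.
move=> subP; exists 0; first exact: subP.1.
by exists v; [exists 1; rewrite ?scale1r | rewrite add0r].
Qed.

Lemma adjoin_isotropic P v : (forall u w, P u -> P w -> orth u w) ->
  (forall u, P u -> orth v u) -> orth v v -> forall u w, adjoin P v u -> adjoin P v w -> orth u w.
Proof.
move=> isoP vP vv _ _ [u Pu [_ [k _ <-] <-]] [w Pw [_ [k' _ <-] <-]].
have lin := orth_linear orthP.
have step u' : orth u' u -> orth u' v -> orth u' (u + k *: v).
  by move=> h1 h2; apply: linear_subD => //; apply: linear_subZ.
apply: (orth_sym orthP); apply: step.
  apply: (orth_sym orthP); apply: linear_subD => //; first exact: isoP.
  by apply: linear_subZ => //; apply: (orth_sym orthP); apply: vP.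
apply: (orth_sym orthP); apply: linear_subD => //; first exact: vP.
exact: linear_subZ.
Qed.

Lemma singular_collinear X s t : singular X -> X s -> X t -> collinear s t.
Proof. by move=> [_ singX] Xs Xt; apply: (singX t Xt s Xs). Qed.

(** Adjoining a vector of such a point to the cone over [M] keeps it totally isotropic, so the point
    is absorbed by maximality. *)
Lemma generator_perp M : generator M -> perp M `<=` M.
Proof.
move=> [singM maxM] y My; have [v yv] := rep_ex (e y).
have subP := adjoin_linear v (cone_linear singM).
have singY : singular (pts (adjoin (cone M) v)).
  apply: pts_singular => //; apply: adjoin_isotropic.
  - by move=> u w; apply: orth_cones => s t; apply: singular_collinear.
  - by move=> u; apply: (orth_cone _ yv) => t Mt; apply: collinear_sym; apply: My.
  - by apply/(orth_collinear orthP yv yv); left.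
rewrite -(maxM _ singY).
  by apply/(pts_rep subP yv); apply: adjoin_mem; apply: cone_linear.
move=> s Ms; have [u su] := rep_ex (e s); apply/(pts_rep subP su).
by apply: adjoin_sub; apply: (cone_rep Ms su).
Qed.

(** A larger subspace contains some [y] not collinear with [x]. Every line of [M] through [y] has a
    second point collinear with [x], hence lies in that subspace. *)
Lemma hyperplane_perp M m x : singular M -> M m -> ~ collinear x m ->
  hyperplane_of (M `&` perp [set x]) M.
Proof.
move=> singM Mm xm.
have subN : subspace (M `&` perp [set x]).
  move=> l ll y z yz ly lz [My xy] [Mz xz] t lt; split.
    exact: (singM.1 l ll y z).
  exact: (subspace_perp ll yz ly lz xy xz).
split=> //.
  split; first by move=> t [].
  by move=> /(_ m Mm)[_ /(_ x erefl)].
move=> Y subY NY YM; have [YN|YN] := EM (Y `<=` M `&` perp [set x]).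
  by left; apply/seteqP.
right; apply/seteqP; split=> // t Mt.
have [y [Yy xy]] : exists y, Y y /\ ~ collinear x y.
  apply: contrapT => ny; apply: YN => y Yy; split; first exact: YM.
  by move=> _ ->; apply: contrapT => xy; apply: ny; exists y.
have [yt|yt] := EM (y = t); first by rewrite -yt.
have [l ll [ly lt]] := collinear_line yt (singular_collinear singM (YM y Yy) Mt).
have [s ls xs] := foot x ll.
have ys : y <> s by move=> ys; apply: xy; rewrite ys.
apply: (subY l ll y s ys ly ls Yy _ t lt); apply: NY; split; last by move=> _ ->.
exact: (singM.1 l ll y t yt ly lt (YM y Yy) Mt).
Qed.

Lemma singular_sub M N : singular M -> subspace N -> N `<=` M -> singular N.
Proof. by move=> [_ sM] subN NM; split=> // x Nx y Ny; apply: sM; apply: NM. Qed.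

Lemma hyperplane_span M N x v : singular M -> hyperplane_of N M -> M x -> ~ N x ->
  rep (e x) v -> cone M `<=` adjoin (cone N) v.
Proof.
move=> singM [subN [NM _] maxN] Mx Nx xv.
have singN := singular_sub singM subN NM.
have subP := adjoin_linear v (cone_linear singN).
have MY : M `&` pts (adjoin (cone N) v) = M.
  have [|||MN|//] := maxN (M `&` pts (adjoin (cone N) v)).
  - move=> l ll y z yz ly lz [My Py] [Mz Pz] t lt; split.
      exact: (singM.1 l ll y z).
    exact: (pts_subspace subP ll yz ly lz Py Pz).
  - move=> s Ns; split; first exact: NM.
    have [u su] := rep_ex (e s); apply/(pts_rep subP su).
    by apply: adjoin_sub; apply: (cone_rep Ns su).
  - by move=> s [].
  case: Nx; rewrite -MN; split=> //; apply/(pts_rep subP xv).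
  by apply: adjoin_mem; apply: cone_linear.
move=> u [->|[s Ms sv]]; first exact: subP.1.
by apply/(pts_rep subP sv); move: Ms; rewrite -{1}MY => -[].
Qed.

Lemma complementary_decomp M M' : complementary e M M' ->
  forall v, exists u u', [/\ cone M u, cone M' u' & v = u + u'].
Proof.
move=> [[sM _] [sM' _] _ /(PG_gen_setT fieldK) gM] v.
have [|u Mu [u' Mu' <-]] := lspan_min (linear_sub_add (cone_linear sM) (cone_linear sM')) _ (gM v).
  move=> w [p [[s Ms <-]|[s Ms <-]] sw].
    exists w; first exact: (cone_rep Ms sw).
    by exists 0; [left | rewrite addr0].
  by exists 0; [left | exists w; [exact: (cone_rep Ms sw) | rewrite add0r]].
by exists u, u'.
Qed.

Lemma complementary_radical M M' v : complementary e M M' ->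
  (forall u, cone M u -> orth v u) -> (forall u, cone M' u -> orth v u) -> v = 0.
Proof.
move=> cMM vM vM'; apply: (orth_nondegenerate orthP) => w.
have [u [u' [Mu Mu' ->]]] := complementary_decomp cMM w.
by apply: (linear_subD (orth_linear orthP v)); [apply: vM | apply: vM'].
Qed.

Lemma complementary_no_perp M M' s : complementary e M M' ->
  ~ ((forall t, M t -> collinear s t) /\ (forall t, M' t -> collinear s t)).
Proof.
move=> cMM [sM sM']; have [v sv] := rep_ex (e s); case/eqP: sv.1.
by apply: (complementary_radical cMM) => u; apply: orth_cone sv.
Qed.

Definition orthogonality_rel (p q : pt (PG V)) : Prop :=
  forall u v, pg_set p u -> pg_set q v -> orth u v.

Lemma orthogonality_relP (p q : pt (PG V)) u v :
  rep p u -> rep q v -> orthogonality_rel p q <-> orth u v.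
Proof.
move=> pu qv; split=> [|uv u' v']; first by apply; [case: pu | case: qv].
rewrite (rep_set fieldK pu) (rep_set fieldK qv) => -[a _ <-] [b _ <-].
apply: (linear_subZ (orth_linear orthP _)); apply: (orth_sym orthP).
by apply: (linear_subZ (orth_linear orthP _)); apply: (orth_sym orthP).
Qed.

Lemma orthogonality_quasi_polarity : emb_orthogonality orthogonality_rel.
Proof.
split.
- split=> [p q pq u v qu pv|p].
    by apply: (orth_sym orthP); apply: pq.
  right; have [u pu] := rep_ex p.
  have RE (q : pt (PG V)) : orthogonality_rel p q <-> pg_set q `<=` orth u.
    have [v qv] := rep_ex q; split=> [/(orthogonality_relP pu qv) uv|].
      exact: pg_subset qv (orth_linear orthP u) uv.
    by move=> sub; apply/(orthogonality_relP pu qv); apply: sub; case: qv.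
  have -> : [set q | orthogonality_rel p q] = [set q | pg_set q `<=` orth u].
    by apply/seteqP; split=> q /RE.
  split; first by apply: PG_subspace_points => //; apply: orth_linear.
    split=> // all; case/eqP: pu.1; apply: (orth_nondegenerate orthP) => v.
    have [->|v0] := eqVneq v 0; first exact: (orth_linear orthP u).1.
    have [q [_ qv]] := pt_ex v0; exact: (all q I v qv).
  move=> Y subY HY _; have [YH|YH] := EM (Y `<=` [set q | pg_set q `<=` orth u]).
    by left; apply/seteqP.
  right; apply/seteqP; split=> // r _.
  have [q [Yq uq]] : exists q : pt (PG V), Y q /\ ~ pg_set q `<=` orth u.
    apply: contrapT => nq; apply: YH => q Yq; apply: contrapT => uq.
    by apply: nq; exists q.
  have [v qv] := rep_ex q; have [w rw] := rep_ex r.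
  have uv : ~ orth u v.
    by move=> uv; apply: uq; apply: pg_subset qv (orth_linear orthP u) uv.
  have [k uk] := orth_codim1 orthP w uv.
  have linY := PG_subspace_linear fieldK subY.
  suff Lw : [set w | w != 0 -> exists2 r', Y r' & rep r' w] w.
    by have [r' Yr' r'w] := Lw rw.1; rewrite (rep_inj fieldK rw r'w).
  rewrite -(subrK (k *: v) w); apply: (linear_subD linY).
    move=> /= /pt_ex[r' r'w]; exists r' => //; apply: HY.
    exact: pg_subset r'w (orth_linear orthP u) uk.
  by apply: (linear_subZ linY) => _ /=; exists q.
- move=> x; have [u xu] := rep_ex (e x); apply/(orthogonality_relP xu xu).
  by apply/(orth_collinear orthP xu xu); left.
- move=> x y; have [u xu] := rep_ex (e x); have [v yv] := rep_ex (e y).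
  split=> [xy|/(orthogonality_relP xu yv)/(orth_collinear orthP xu yv)//].
  by apply/(orthogonality_relP xu yv); apply/(orth_collinear orthP xu yv).
Qed.

Lemma cone_adjoin_orth N v w : (forall u, cone N u -> orth w u) -> orth w v ->
  forall u, adjoin (cone N) v u -> orth w u.
Proof.
move=> wN wv _ [u Nu [_ [k _ <-] <-]]; have lin := orth_linear orthP w.
by apply: linear_subD => //; [apply: wN | apply: linear_subZ].
Qed.

(** * Sub-generators of a complemented generator *)

Section ComplementedGenerator.
Variables (M N M' : set (pt S)).
Hypotheses (cMM : complementary e M M') (NM : hyperplane_of N M).

Let genM : generator M. Proof. by case: cMM. Qed.
Let genM' : generator M'. Proof. by case: cMM. Qed.
Let singM : singular M. Proof. by case: genM. Qed.
Let singM' : singular M'. Proof. by case: genM'. Qed.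
Let singN : singular N.
Proof. by case: NM => subN [sNM _] _; apply: singular_sub singM subN sNM. Qed.
Let subNM : N `<=` M. Proof. by case: NM => _ []. Qed.

(** A point of [perp N] outside [M] has a nonzero component in [M'], which gives [y]. Were [x]
    collinear with [y], then [y] would be orthogonal to [M] and [M'], contrary to nondegeneracy. *)
Lemma sub_generator_pair : ~ generator (perp N) ->
  exists x y, [/\ M x, ~ N x, M' y, perp N y & ~ collinear x y].
Proof.
move=> ngN; have lin := orth_linear orthP.
have [x Mx Nx] : exists2 x, M x & ~ N x.
  apply: contrapT => nx; have [_ [_ MN] _] := NM; apply: MN => x Mx.
  by apply: contrapT => Nx; apply: nx; exists x.
have MNp : M `<=` perp N.
  by move=> s Ms t Nt; apply: (singular_collinear singM) => //; apply: subNM.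
have [p Np Mp] : exists2 p, perp N p & ~ M p.
  apply: contrapT => np; apply: ngN; suff -> : perp N = M by [].
  apply/seteqP; split=> // p Np.
  by apply: contrapT => Mp; apply: np; exists p.
have [v pv] := rep_ex (e p).
have [u [u' [Mu Mu' vE]]] := complementary_decomp cMM v.
case: Mu' => [u'0|[y My yu']].
  case: Mu => [u0|[s Ms su]]; first by case/eqP: pv.1; rewrite vE u0 u'0 addr0.
  by rewrite u'0 addr0 in vE; rewrite vE in pv; case: Mp; rewrite (emb_rep_inj pv su).
exists x, y; split=> //.
  move=> t Nt; have [w tw] := rep_ex (e t); apply/(orth_collinear orthP tw yu').
  apply: (linear_subDl (lin w) (u := u)).
    by apply: (orth_cone _ tw Mu) => s Ms; apply: (singular_collinear singM) => //; apply: subNM.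
  by rewrite -vE; apply/(orth_collinear orthP tw pv); apply: Np.
move=> xy; have [vx xv] := rep_ex (e x).
have Ny : forall n, cone N n -> orth u' n.
  move=> n [->|[t Nt tn]]; first exact: (lin u').1.
  have tu : orth n u.
    by apply: (orth_cone _ tn Mu) => s Ms; apply: (singular_collinear singM) => //; apply: subNM.
  apply: (orth_sym orthP); apply: (linear_subDl (lin n) tu); rewrite -vE.
  by apply/(orth_collinear orthP tn pv); apply: Np.
case/eqP: yu'.1; apply: (complementary_radical cMM) => [w|w Mw].
  move/(hyperplane_span singM NM Mx Nx xv).
  apply: (cone_adjoin_orth Ny).
  by apply: (orth_sym orthP); apply/(orth_collinear orthP xv yu').
by apply: (orth_cone _ yu' Mw) => t; apply: singular_collinear.
Qed.

Variables (x y : pt S).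
Hypotheses (Mx : M x) (Nx : ~ N x) (My : M' y) (Ny : perp N y) (xy : ~ collinear x y).

Lemma complementary_span u : rep (e x) u -> cone M `<=` adjoin (cone N) u.
Proof. exact: hyperplane_span singM NM Mx Nx. Qed.

Lemma sub_generator_perp : perp N = gen (N `|` perp (perp [set x; y])).
Proof.
have Nxy : N `<=` perp [set x; y].
  move=> t Nt _ [->|->]; first by apply: (singular_collinear singM) => //; apply: subNM.
  by apply: collinear_sym; apply: Ny.
apply/seteqP; split; last first.
  apply: gen_min; first exact: subspace_perp.
  move=> t [Nt s Ns|tt s Ns]; first exact: (singular_collinear singN).
  by apply: tt; apply: Nxy.
move=> q Nq; have [vq qv] := rep_ex (e q).
have [vx xv] := rep_ex (e x); have [vy yv] := rep_ex (e y).
have lin := orth_linear orthP.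
have oxy : ~ orth vx vy by move/(orth_collinear orthP xv yv).
have [u [u' [Mu Mu' vqE]]] := complementary_decomp cMM vq.
have [n Nn [_ [a _ <-] uE]] := complementary_span xv Mu.
(* The component [u'] is a multiple of [vy]: subtracting the multiple that makes it orthogonal to
   [x] leaves a vector orthogonal to [N], [x] and [M'], hence zero. *)
have [k hk] := orth_codim1 orthP u' oxy.
have M'y : cone M' vy by apply: cone_rep yv.
have z0 : u' - k *: vy = 0.
  have M'z : cone M' (u' - k *: vy).
    by apply: (linear_subB (cone_linear singM')) => //; apply: (linear_subZ (cone_linear singM')).
  apply: (complementary_radical cMM) => [w /(complementary_span xv)|w M'w].
    apply: cone_adjoin_orth; last exact: (orth_sym orthP).
    move=> w' Nw'; apply: (orth_sym orthP); apply: (linear_subB (lin _)).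
      apply: (linear_subDl (lin w') (u := u)).
        apply: (orth_cones (X := N) (Y := M)) => // s t Ns Mt.
        by apply: (singular_collinear singM) => //; apply: subNM.
      rewrite -vqE; apply: (orth_sym orthP); apply: (orth_cone _ qv Nw') => t Nt.
      by apply: collinear_sym; apply: Nq.
    apply: (linear_subZ (lin _)); apply: (orth_sym orthP); apply: (orth_cone _ yv Nw') => t Nt.
    by apply: collinear_sym; apply: Ny.
  by apply: (orth_cones (X := M') (Y := M')) => // s t; apply: singular_collinear.
have {}vqE : vq = n + (a *: vx + k *: vy).
  by rewrite vqE -uE -(subrK (k *: vy) u') z0 add0r addrA.
set c := a *: vx + k *: vy in vqE.
have c_pt r : rep (e r) c -> perp (perp [set x; y]) r.
  move=> rc t txy; have [w tw] := rep_ex (e t).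
  apply/(orth_collinear orthP tw rc).
  apply: (linear_subD (lin w)); apply: (linear_subZ (lin w)).
    by apply/(orth_collinear orthP tw xv); apply: collinear_sym; apply: txy; left.
  by apply/(orth_collinear orthP tw yv); apply: collinear_sym; apply: txy; right.
case: Nn => [n0|[s Ns sn]].
  by apply: subset_gen; right; apply: c_pt; rewrite n0 add0r in vqE; rewrite -vqE.
have [c0|c0] := eqVneq c 0.
  apply: subset_gen; left; suff -> : q = s by [].
  by apply: (emb_rep_inj qv); rewrite vqE c0 addr0.
(* As a combination of the collinear points [q] and [s], the vector [c] is singular, so it gives a
   point of the hyperbolic line. *)
have cE : c = 1 *: vq + (-1) *: n by rewrite scale1r scaleN1r vqE addrC addKr.
have qs : collinear q s by apply: collinear_sym; apply: Nq.
have [|r rc rX] := emb_comb (a := 1) (b := -1) qs qv sn; first by rewrite -cE.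
rewrite -cE in rc.
have sr : collinear s r.
  by apply: (rX (perp [set s]) (subspace_perp (X := _)) _ _ s erefl) => _ ->;
    [apply: collinear_sym | left].
apply: (emb_comb_mem (a := 1) (b := 1) (@subspace_gen _ _) _ _ sr sn rc).
- by apply: subset_gen; left.
- by apply: subset_gen; right; apply: c_pt.
- by rewrite !scale1r -vqE.
Qed.

Let N' := M' `&` perp [set x].

Lemma complement_sub_generator : sub_generator N'.
Proof.
have hN' : hyperplane_of N' M' by apply: hyperplane_perp My xy.
split; last by exists M'.
by case: (hN') => subN' [sNM' _] _; apply: singular_sub singM' subN' sNM'.
Qed.

Lemma complement_perp t : (forall s, N s -> collinear t s) -> collinear t x ->
  forall s, M s -> collinear t s.
Proof.
move=> tN tx s Ms; have [w tw] := rep_ex (e t); have [u su] := rep_ex (e s).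
have [v xv] := rep_ex (e x).
apply/(orth_collinear orthP tw su).
apply: (cone_adjoin_orth (N := N) (v := v)).
- by move=> n; apply: orth_cone tw.
- exact/(orth_collinear orthP tw xv).
by apply: complementary_span => //; apply: cone_rep su.
Qed.

Lemma complement_perp' t : (forall s, N' s -> collinear t s) -> collinear t y ->
  forall s, M' s -> collinear t s.
Proof.
move=> tN ty s Ms; have [w tw] := rep_ex (e t); have [u su] := rep_ex (e s).
have [v yv] := rep_ex (e y).
have hN' : hyperplane_of N' M' by apply: hyperplane_perp My xy.
have N'y : ~ N' y by case=> _ /(_ x erefl).
have [singN' _] := complement_sub_generator.
apply/(orth_collinear orthP tw su).
apply: (cone_adjoin_orth (N := N') (v := v)).
- by move=> n; apply: orth_cone tw.
- exact/(orth_collinear orthP tw yv).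
by apply: (hyperplane_span singM' hN' My N'y yv); apply: cone_rep su.
Qed.

(** A point violating this would be collinear with all of [M] and [M'], because [N] and [x] span
    [M], and [N'] and [y] span [M']. *)
Lemma complement_opposite : opposite N N'.
Proof.
split; apply/seteqP; split=> // t [].
  move=> Nt [Mt' xt]; apply: (complementary_no_perp (s := t) cMM); split.
    apply: complement_perp; last by apply: collinear_sym; apply: xt.
    by move=> s Ns; apply: collinear_sym; apply: Nt.
  by move=> s Ms'; apply: (singular_collinear singM').
move=> N't Nt; apply: (complementary_no_perp (s := t) cMM); split.
  by move=> s Ms; apply: (singular_collinear singM) => //; apply: subNM.
apply: complement_perp'; last exact: Ny.
by move=> s N's; apply: collinear_sym; apply: N't.
Qed.

(** All of [X] is collinear with [x] and [y], so its radical is empty and the right-hand side of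
    optimality is the whole space. This is spanned by [N], [N'] and the points [x], [y] orthogonal
    to [X]. *)
Lemma complement_optimally_embeddable : optimally_embeddable (gen (N `|` N')).
Proof.
set X := gen _.
have Xx : X `<=` perp [set x; y].
  apply: gen_min; first exact: subspace_perp.
  move=> t [Nt|[Mt' xt]] _ [->|->].
  - by apply: (singular_collinear singM) => //; apply: subNM.
  - by apply: collinear_sym; apply: Ny.
  - exact: xt.
  - exact: (singular_collinear singM').
have XX : X `&` perp X = set0.
  apply/seteqP; split=> // t [Xt pXt]; apply: (complementary_no_perp (s := t) cMM); split.
    apply: complement_perp; last by apply: collinear_sym; apply: (Xx t Xt); left.
    by move=> s Ns; apply: collinear_sym; apply: pXt; apply: subset_gen; left.
  apply: complement_perp'; last by apply: collinear_sym; apply: (Xx t Xt); right.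
  by move=> s Ns; apply: collinear_sym; apply: pXt; apply: subset_gen; right.
have oR := orthogonality_quasi_polarity.
exists e, orthogonality_rel; split; first exact: oR.
rewrite XX image_set0; have -> : rel_perp orthogonality_rel set0 = setT.
  by apply/seteqP; split=> // r _ r0 [].
have [_ _ colR] := oR.
apply/(PG_gen_setT fieldK) => v.
have [vx xv] := rep_ex (e x); have [vy yv] := rep_ex (e y).
have hN' : hyperplane_of N' M' by apply: hyperplane_perp My xy.
have N'y : ~ N' y by case=> _ /(_ x erefl).
have [u [u' [Mu Mu' ->]]] := complementary_decomp cMM v.
have [n Nn [_ [a _ <-] <-]] := complementary_span xv Mu.
have [n' Nn' [_ [b _ <-] <-]] := hyperplane_span singM' hN' My N'y yv Mu'.
have lin := lspan_linear.
have Lx t vt : [set x; y] t -> rep (e t) vt ->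
    lspan (vectors (e @` X `|` rel_perp orthogonality_rel (e @` X))) vt.
  move=> xyt tv; apply: lspan_gen; exists (e t) => //; right.
  by move=> _ [s Xs <-]; apply/colR; apply: collinear_sym; apply: (Xx s Xs).
apply: linear_subD => //; apply: linear_subD => //.
- apply: (cone_lspan _ Nn); apply: subset_trans (@subsetUl _ _ _).
  by apply: image_subset => t Nt; apply: subset_gen; left.
- by apply: linear_subZ => //; apply: (Lx x _ _ xv); left.
- apply: (cone_lspan _ Nn'); apply: subset_trans (@subsetUl _ _ _).
  by apply: image_subset => t Nt; apply: subset_gen; right.
- by apply: linear_subZ => //; apply: (Lx y _ _ yv); right.
Qed.

End ComplementedGenerator.

(** * Hyperbolic lines and common orthogonals *)

Lemma cone_comb u v a b : cone setT u -> cone setT v -> orth u v -> cone setT (a *: u + b *: v).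
Proof.
move=> cu cv uv.
have [w0|w0] := eqVneq (a *: u + b *: v) 0; first by left.
case: cu => [u0|[s _ su]]; [|case: cv => [v0|[t _ tv]]].
- case: cv => [v0|[t _ tv]]; first by case/eqP: w0; rewrite u0 v0 !scaler0 addr0.
  right; exists t => //; rewrite u0 scaler0 add0r in w0 *; apply: rep_scale => //.
  by apply: contra_neq w0 => ->; rewrite scale0r.
- right; exists s => //; rewrite v0 scaler0 addr0 in w0 *; apply: rep_scale => //.
  by apply: contra_neq w0 => ->; rewrite scale0r.
have [r rw _] := emb_comb ((orth_collinear orthP su tv).1 uv) su tv w0.
by right; exists r.
Qed.

Lemma cone_setT X : cone X `<=` cone setT.
Proof. by move=> v [->|[s _ sv]]; [left | right; exists s]. Qed.

Lemma cone_mem X s v : cone X v -> rep (e s) v -> X s.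
Proof.
case=> [->|[t Xt tv] sv]; first by case; rewrite eqxx.
by rewrite (emb_rep_inj sv tv).
Qed.

(* [x^perp] is spanned by [x] and [{x, y}^perp], so that the latter spans a
   subspace of codimension 2, whose orthogonal is the line through [x] and [y]. *)
Lemma hyperbolic_line x y t u v w : ~ collinear x y -> rep (e x) u -> rep (e y) v ->
  perp (perp [set x; y]) t -> rep (e t) w -> exists a b, w = a *: u + b *: v.
Proof.
move=> xy xu yv xyt tw; have lin := orth_linear orthP.
have uv : ~ orth u v by move/(orth_collinear orthP xu yv).
have vu : ~ orth v u by move/(orth_sym orthP).
have uu : orth u u by apply/(orth_collinear orthP xu xu); left.
have vv : orth v v by apply/(orth_collinear orthP yv yv); left.
have [k uk] := orth_codim1 orthP w uv.
have [k' vk'] := orth_codim1 orthP (w - k *: v) vu.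
set z := _ - k' *: u in vk'.
have uz : orth u z by apply: linear_subB => //; apply: linear_subZ.
suff z0 : z = 0.
  by exists k', k; rewrite -[LHS](subrK (k *: v)) -[w - _](subrK (k' *: u)) -/z z0 add0r.
apply: (orth_nondegenerate orthP) => w1.
have [b1 h1] := tangent_complement xy yv w1.
rewrite -(subrK (b1 *: v) w1); apply: linear_subD => //; last first.
  by apply: linear_subZ => //; apply: (orth_sym orthP).
apply: (lspan_min _ _ h1) => // w2 [_ [s xs <-] sw2].
have {}xs : collinear x s by apply: xs.
have [s_x|s_x] := EM (s = x).
  rewrite s_x in sw2; have [c _ ->] := rep_prop fieldK xu sw2.
  by apply: linear_subZ => //; apply: (orth_sym orthP).
have [l ll [lx ls]] := collinear_line (not_eq_sym s_x) xs.
(* The point [r] is collinear with [x] and [y], hence with [t]; and [s] is a combination of [r] and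
   [x]. *)
have [r lr yr] := foot y ll.
have rx : r <> x by move=> rx; apply: xy; rewrite -rx; apply: collinear_sym.
have [d rd] := rep_ex (e r).
have [a [b ->]] := emb_line_span ll lr lx rx ls rd xu sw2.
apply: linear_subD => //; apply: linear_subZ => //; last exact: (orth_sym orthP).
apply: (orth_sym orthP).
have dt : orth d w.
  apply/(orth_collinear orthP rd tw); apply: xyt => _ [->|->] //.
  exact: (line_collinear ll).
apply: linear_subB => //; last first.
  by apply: linear_subZ => //; apply/(orth_collinear orthP rd xu); apply: (line_collinear ll).
apply: linear_subB => //; apply: linear_subZ => //.
by apply/(orth_collinear orthP rd yv); apply: collinear_sym.
Qed.

(** For opposite sub-generators this is the third summand of [V] in the decomposition supplied by
    optimality. *)
Definition ortho2 X Y : set V :=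
  [set v | (forall u, cone X u -> orth v u) /\ (forall u, cone Y u -> orth v u)].

Lemma ortho2_linear X Y : linear_sub (ortho2 X Y).
Proof.
have lin := orth_linear orthP.
have half Z : linear_sub [set v | forall u, cone Z u -> orth v u].
  split=> [u _|a v w hv hw u Zu]; first by apply: (orth_sym orthP); apply: (lin u).1.
  apply: (orth_sym orthP); apply: (lin u).2; apply: (orth_sym orthP); [exact: hv | exact: hw].
split; first by split; [apply: (half X).1 | apply: (half Y).1].
by move=> a v w [v1 v2] [w1 w2]; split; [apply: (half X).2 | apply: (half Y).2].
Qed.

(** * Construction of a complement *)

Section ConstructComplement.
Variables (M N N' : set (pt S)).
Hypotheses (genM : generator M) (NM : hyperplane_of N M).
Hypotheses (singN' : singular N') (oppN : opposite N N').
Hypothesis decN : forall v,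
  [set u + w | u in [set u + w | u in cone N & w in cone N'] & w in ortho2 N N'] v.

Let singM : singular M. Proof. by case: genM. Qed.
Let singN : singular N.
Proof. by case: NM => subN [sNM _] _; apply: singular_sub singM subN sNM. Qed.
Let subNM : N `<=` M. Proof. by case: NM => _ []. Qed.
Let isoN v w : cone N v -> cone N w -> orth v w.
Proof. by apply: orth_cones => s t; apply: singular_collinear. Qed.
Let isoN' v w : cone N' v -> cone N' w -> orth v w.
Proof. by apply: orth_cones => s t; apply: singular_collinear. Qed.

Let orthN_N' v : cone N' v -> (forall u, cone N u -> orth v u) -> v = 0.
Proof.
case=> [//|[s N's sv] vN]; have [oN _] := oppN.
have : (perp N `&` N') s; last by rewrite oN.
split=> // t Nt; have [w tw] := rep_ex (e t); apply/(orth_collinear orthP tw sv).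
by apply: (orth_sym orthP); apply: vN; apply: cone_rep tw.
Qed.

Let orthN'_N v : cone N v -> (forall u, cone N' u -> orth v u) -> v = 0.
Proof.
case=> [//|[s Ns sv] vN]; have [_ oN] := oppN.
have : (perp N' `&` N) s; last by rewrite oN.
split=> // t Nt; have [w tw] := rep_ex (e t); apply/(orth_collinear orthP tw sv).
by apply: (orth_sym orthP); apply: vN; apply: cone_rep tw.
Qed.

(** The component in [N'] is orthogonal to [N], since [v] and the other two components are; by
    oppositeness it is zero. *)
Lemma perp_decomp v : (forall u, cone N u -> orth v u) ->
  exists n (z : V), [/\ cone N n, ortho2 N N' z & v = n + z].
Proof.
move=> vN; have [_ [n Nn [n' Nn' <-]] [z Zz vE]] := decN v.
exists n, z; split=> //; rewrite -vE.
suff -> : n' = 0 by rewrite addr0.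
apply: orthN_N' => // u Nu; apply: (orth_sym orthP).
have lin := orth_linear orthP u.
apply: (linear_subDl lin (u := n)); first exact: isoN.
apply: (linear_subDl lin (u := z)); first by apply: (orth_sym orthP); apply: Zz.1.
by rewrite addrC vE; apply: (orth_sym orthP); apply: vN.
Qed.

Lemma perp_decomp_cone v n (z : V) : (forall u, cone N u -> orth v u) -> cone setT v ->
  cone N n -> v = n + z -> cone setT z.
Proof.
move=> vN cv Nn vE; have -> : z = 1 *: v + (-1) *: n.
  by rewrite scale1r scaleN1r vE addrC addKr.
by apply: cone_comb => //; [apply: cone_setT Nn | apply: vN].
Qed.

Section HyperbolicPair.
Variables (u v : V).
Hypotheses (cu : cone setT u) (cv : cone setT v) (uv : ~ orth u v).
Hypotheses (Zu : ortho2 N N' u) (Zv : ortho2 N N' v).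
Hypothesis perpN : forall w, cone setT w -> (forall n, cone N n -> orth w n) ->
  adjoin (adjoin (cone N) u) v w.

Let P : set V := adjoin (adjoin [set n + n' | n in cone N & n' in cone N'] u) v.
Let linP0 : linear_sub [set n + n' | n in cone N & n' in cone N'].
Proof. by apply: linear_sub_add; apply: cone_linear. Qed.
Let linP : linear_sub P. Proof. by do 2 apply: adjoin_linear. Qed.
Let linPu : linear_sub (adjoin [set n + n' | n in cone N & n' in cone N'] u).
Proof. exact: adjoin_linear. Qed.
Let NP n : cone N n -> P n.
Proof. by move=> Nn; do 2 apply: adjoin_sub; exists n => //; exists 0; [left | rewrite addr0]. Qed.
Let N'P n : cone N' n -> P n.
Proof. by move=> Nn; do 2 apply: adjoin_sub; exists 0; [left | exists n; rewrite // add0r]. Qed.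
Let uP : P u. Proof. by apply: adjoin_sub; apply: adjoin_mem. Qed.
Let vP : P v. Proof. exact: adjoin_mem. Qed.

Lemma isotropic_orth w : cone setT w -> orth w w.
Proof.
case=> [->|[s _ sw]]; first exact: (orth_linear orthP 0).1.
by apply/(orth_collinear orthP sw sw); left.
Qed.

(* Adding to [w] a singular vector [- n' - k c] orthogonal to it, where [n'] is
   the component of [w] in [N'], moves [w] into the orthogonal of [N]. *)
Lemma span_step (c : V) w : cone setT c -> ortho2 N N' c -> P c -> cone setT w ->
  ~ orth c w -> P w.
Proof.
move=> cc Zc Pc cw cNw; have lin := orth_linear orthP.
have [_ [n Nn [n' Nn' <-]] [z Zz wE]] := decN w.
have [k wk] : exists k, orth w (- n' - k *: c).
  by apply: (orth_codim1 orthP) => wc; apply: cNw; apply: (orth_sym orthP).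
have cq : cone setT (- n' - k *: c).
  rewrite -scaleN1r -scaleNr; apply: cone_comb => //; first exact: cone_setT Nn'.
  by apply: (orth_sym orthP); apply: Zc.2.
have := cone_comb 1 1 cw cq wk; rewrite !scale1r => cwq.
have wqE : w + (- n' - k *: c) = n + (z - k *: c).
  by rewrite -wE -!addrA; congr (_ + _); rewrite addrCA addNKr.
have Pwq : P (w + (- n' - k *: c)).
  have [|_ [m Nm [_ [a _ <-] <-]] [_ [b _ <-] <-]] := perpN cwq.
    move=> m Nm; rewrite wqE; apply: (orth_sym orthP).
    apply: linear_subD => //; first exact: isoN.
    apply: linear_subB => //; first by apply: (orth_sym orthP); apply: Zz.1.
    by apply: linear_subZ => //; apply: (orth_sym orthP); apply: Zc.1.
  by do 2 (apply: linear_subD => //; last exact: linear_subZ); apply: NP.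
rewrite -(addrK (- n' - k *: c) w); apply: linear_subB => //.
by apply: linear_subB => //; [apply: linear_subN => //; apply: N'P | apply: linear_subZ].
Qed.

(** Singular vectors span [V], and [span_step] handles those not orthogonal to both [u] and [v]. If
    [w] is orthogonal to both, then [u + w] is singular and not orthogonal to [v]. *)
Lemma hyperbolic_pair_span w : P w.
Proof.
apply: (lspan_min linP _ (emb_span_lspan w)) => {}w [_ [s _ <-] sw].
have cw : cone setT w by apply: cone_rep sw.
have [uw|] := EM (orth u w); last exact: (span_step cu).
have [vw|] := EM (orth v w); last exact: (span_step cv).
have cuw : cone setT (1 *: u + 1 *: w) by apply: cone_comb.
rewrite !scale1r in cuw.
apply: (linear_subDl linP uP); apply: (span_step cv) => // h.
apply: uv; apply: (orth_sym orthP).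
by apply: (linear_subDl (orth_linear orthP v) vw); rewrite addrC.
Qed.

End HyperbolicPair.

Section Complement.
Variable c : V.
Hypotheses (cc : cone setT c) (Zc : ortho2 N N' c).
Hypothesis spanMN' : forall v, [set u + w | u in cone M & w in adjoin (cone N') c] v.

Let M' : set (pt S) := pts (adjoin (cone N') c).
Let linQ : linear_sub (adjoin (cone N') c). Proof. by apply: adjoin_linear; apply: cone_linear. Qed.
Let isoQ v w : adjoin (cone N') c v -> adjoin (cone N') c w -> orth v w.
Proof.
apply: adjoin_isotropic => //; first by move=> x; apply: Zc.2.
exact: isotropic_orth.
Qed.
Let singM' : singular M'. Proof. exact: pts_singular. Qed.
Let coneM' v : adjoin (cone N') c v -> cone M' v.
Proof.
move=> Qv; suff [v0|[s _ sv]] : cone setT v.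
- by left.
- by right; exists s => //; apply/(pts_rep linQ sv).
case: Qv => n' Nn' [_ [k _ <-] <-]; rewrite -[n']scale1r; apply: cone_comb => //.
  exact: cone_setT Nn'.
by apply: (orth_sym orthP); apply: Zc.2.
Qed.
Let radical v : (forall u, cone M u -> orth v u) ->
  (forall u, adjoin (cone N') c u -> orth v u) -> v = 0.
Proof.
move=> vM vQ; apply: (orth_nondegenerate orthP) => w.
have [x Mx [y Qy <-]] := spanMN' w.
by apply: (linear_subD (orth_linear orthP v)); [apply: vM | apply: vQ].
Qed.

(** As [M] and [M'] span [V], a vector orthogonal to both is zero. This gives oppositeness, and also
    maximality of [M']: the component in [M] of a point of a larger singular subspace is orthogonal
    to both. *)
Lemma construct_complement : complementary e M M'.
Proof.
have gM' : generator M'.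
  split=> // Y singY M'Y; apply/seteqP; split=> // s Ys.
  have [v sv] := rep_ex (e s); apply/(pts_rep linQ sv).
  have [x Mx [y Qy vE]] := spanMN' v.
  suff x0 : x = 0 by rewrite -vE x0 add0r.
  apply: radical => [x' Mx'|w Qw].
    by apply: (orth_cones (X := M) (Y := M)) Mx' => // t t'; apply: singular_collinear.
  apply: (orth_sym orthP); apply: (linear_subDl (orth_linear orthP w) (isoQ Qw Qy)).
  rewrite addrC vE; apply: (orth_sym orthP); apply: (orth_cone _ sv (coneM' Qw)) => t M't.
  by apply: (singular_collinear singY) => //; apply: M'Y.
have no s : ~ ((forall t, M t -> collinear s t) /\ (forall t, M' t -> collinear s t)).
  move=> [sM sM']; have [v sv] := rep_ex (e s); case/eqP: sv.1; apply: radical.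
    by move=> x; apply: orth_cone sv.
  by move=> y /coneM'; apply: orth_cone sv.
split=> //.
  split; apply/seteqP; split=> // s [h1 h2]; apply: (no s); split=> t ht.
  - by apply: collinear_sym; apply: h1.
  - exact: (singular_collinear singM').
  - exact: (singular_collinear singM).
  - by apply: collinear_sym; apply: h1.
apply/(PG_gen_setT fieldK) => v; have [x Mx [y Qy <-]] := spanMN' v.
apply: linear_subD; first exact: lspan_linear.
  exact: (cone_lspan (@subsetUl _ _ _) Mx).
exact: (cone_lspan (@subsetUr _ _ _) (coneM' Qy)).
Qed.

End Complement.

Lemma perp_minimal_complement x y : perp N x -> perp N y -> ~ collinear x y ->
  perp N = gen (N `|` perp (perp [set x; y])) -> exists M', complementary e M M'.
Proof.
move=> Nx Ny xy perpNE.
have [vx xv] := rep_ex (e x); have [vy yv] := rep_ex (e y).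
have lin := orth_linear orthP.
have vxN n : cone N n -> orth vx n.
  by apply: orth_cone xv => t Nt; apply: collinear_sym; apply: Nx.
have vyN n : cone N n -> orth vy n.
  by apply: orth_cone yv => t Nt; apply: collinear_sym; apply: Ny.
(* The given pair is replaced by its components orthogonal to [N] and [N'], which are still singular
   and not orthogonal to each other. *)
have [n1 [u [Nn1 Zu vxE]]] := perp_decomp vxN.
have [n2 [v [Nn2 Zv vyE]]] := perp_decomp vyN.
have cvx : cone setT vx by apply: cone_rep xv.
have cvy : cone setT vy by apply: cone_rep yv.
have cu := perp_decomp_cone vxN cvx Nn1 vxE.
have cv := perp_decomp_cone vyN cvy Nn2 vyE.
have uv : ~ orth u v.
  move=> uv; apply: xy; apply/(orth_collinear orthP xv yv); apply: (orth_sym orthP).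
  rewrite vxE; apply: linear_subD => //; first exact: vyN.
  by apply: (orth_sym orthP); rewrite vyE; apply: linear_subD => //; apply: Zu.1.
pose P1 := adjoin (adjoin (cone N) u) v.
have linP1 : linear_sub P1 by do 2 apply: adjoin_linear; apply: cone_linear.
have NP1 n : cone N n -> P1 n by move=> Nn; do 2 apply: adjoin_sub.
have uP1 : P1 u by apply: adjoin_sub; apply: adjoin_mem; apply: cone_linear.
have vP1 : P1 v by apply: adjoin_mem; apply: adjoin_linear; apply: cone_linear.
have perpN w : cone setT w -> (forall n, cone N n -> orth w n) -> P1 w.
  case=> [-> _|[s _ sw] wN]; first exact: linP1.1.
  apply/(pts_rep linP1 sw).
  have : perp N s.
    move=> t Nt; have [d td] := rep_ex (e t); apply/(orth_collinear orthP td sw).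
    by apply: (orth_sym orthP); apply: wN; apply: cone_rep td.
  rewrite perpNE; apply: gen_min; first exact: pts_subspace.
  move=> t [Nt|xyt]; have [d td] := rep_ex (e t); apply/(pts_rep linP1 td).
    by apply: NP1; apply: cone_rep td.
  have [a [b ->]] := hyperbolic_line xy xv yv xyt td.
  apply: linear_subD => //; apply: linear_subZ => //; rewrite (vxE, vyE);
    by apply: linear_subD => //; apply: NP1.
have spanP := hyperbolic_pair_span cu cv uv Zu Zv perpN.
have [m Mm Nm] : exists2 m, M m & ~ N m.
  apply: contrapT => nm; have [_ [_ MN] _] := NM; apply: MN => m Mm.
  by apply: contrapT => Nm; apply: nm; exists m.
have [vm mv] := rep_ex (e m).
have vmN n : cone N n -> orth vm n.
  by apply: orth_cone mv => t Nt; apply: (singular_collinear singM) => //; apply: subNM.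
(* A point of [M] outside [N] yields a nonzero vector [z] of [M] orthogonal to [N'] as well; it
   turns out to be a combination of [u] and [v]. *)
have [n [z [Nn Zz vmE]]] := perp_decomp vmN.
have NcM (d : V) : cone N d -> cone M d.
  by case=> [->|[s Ns sk]]; [left | right; exists s => //; apply: subNM].
have Mz : cone M z.
  rewrite -(addKr n z) -vmE addrC; apply: (linear_subB (cone_linear singM)).
    exact: cone_rep mv.
  exact: NcM.
have z0 : z <> 0.
  by move=> z0; apply: Nm; apply: cone_mem mv; rewrite vmE z0 addr0.
have [_ [n3 Nn3 [_ [a _ <-] <-]] [_ [b _ <-] zE]] := perpN z (cone_setT Mz) Zz.1.
have linZ := ortho2_linear N N'.
have n30 : n3 = 0.
  apply: orthN'_N => //.
  suff [] : ortho2 N N' n3 by [].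
  apply: (linear_subDl linZ (u := b *: v)); first exact: linear_subZ.
  rewrite addrC; apply: (linear_subDl linZ (u := a *: u)); first exact: linear_subZ.
  by rewrite addrA (addrC _ n3) zE.
rewrite n30 add0r in zE.
(* The vector [c] is whichever of [u] and [v] spans, together with [z], the plane of [u] and [v]. *)
have [c [cc Zc span_c]] : exists c : V, [/\ cone setT c, ortho2 N N' c &
    forall Q : set V, linear_sub Q -> Q z -> Q c -> Q u /\ Q v].
  have [b0|b0] := eqVneq b 0.
    exists v; split=> // Q linQ Qz Qv; split=> //.
    have a0 : a != 0 by apply: contra_notN z0 => /eqP a0; rewrite -zE a0 b0 !scale0r addr0.
    rewrite b0 scale0r addr0 in zE.
    by rewrite -(scaleVK fieldK u a0) zE; apply: linear_subZ.
  exists u; split=> // Q linQ Qz Qu; split=> //.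
  rewrite -(scaleVK fieldK v b0); apply: linear_subZ => //.
  by apply: (linear_subDl linQ (u := a *: u)); [apply: linear_subZ | rewrite zE].
exists (pts (adjoin (cone N') c)); apply: construct_complement => // w.
have linQ : linear_sub (adjoin (cone N') c) by apply: adjoin_linear; apply: cone_linear.
have linR := linear_sub_add (cone_linear singM) linQ.
have MR (k : V) : cone M k -> [set u + w | u in cone M & w in adjoin (cone N') c] k.
  by move=> Mk; exists k => //; exists 0; [apply: linQ.1 | rewrite addr0].
have QR (k : V) : adjoin (cone N') c k -> [set u + w | u in cone M & w in adjoin (cone N') c] k.
  by move=> Qk; exists 0; [left | exists k; rewrite // add0r].
have [Ru Rv] := span_c _ linR (MR _ Mz) (QR _ (adjoin_mem c (cone_linear singN'))).
have [_ [_ [k1 Nk1 [k2 Nk2 <-]] [_ [a1 _ <-] <-]] [_ [b1 _ <-] <-]] := spanP w.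
apply: (linear_subD linR); last exact: (linear_subZ linR).
apply: (linear_subD linR); last exact: (linear_subZ linR).
apply: (linear_subD linR); first by apply: MR; apply: NcM.
by apply: QR; apply: adjoin_sub.
Qed.

End ConstructComplement.

(* The decomposition holds for the embedding [e'] by hypothesis; it is carried
   over to [e] by the morphism making [e] a quotient of [e'], because the
   orthogonal of [e' t] is the tangent hyperplane at [t]. *)
Lemma optimally_embeddable_decomp N N' : minimum_embedding e -> singular N -> singular N' ->
  opposite N N' -> optimally_embeddable (gen (N `|` N')) ->
  forall v, [set u + w | u in [set u + w | u in cone N & w in cone N'] & w in ortho2 N N'] v.
Proof.
move=> min_e singN singN' [oppN oppN'] [e' [R [[[_ quasiR] _ colR] genX]]].
set X := gen (N `|` N') in genX; set T := (X in forall v, X v).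
have lin := orth_linear orthP.
have linNN := linear_sub_add (cone_linear singN) (cone_linear singN').
have linT : linear_sub T := linear_sub_add linNN (ortho2_linear N N').
have NNT v : [set u + w | u in cone N & w in cone N'] v -> T v.
  by move=> h; exists v => //; exists 0; [apply: (ortho2_linear N N').1 | rewrite addr0].
have XNN : X `<=` pts [set u + w | u in cone N & w in cone N'].
  apply: gen_min; first exact: pts_subspace.
  move=> t [Nt|Nt]; have [d td] := rep_ex (e t); apply/(pts_rep linNN td).
    by exists d; [apply: cone_rep td | exists 0; [left | rewrite addr0]].
  by exists 0; [left | exists d; [apply: cone_rep td | rewrite add0r]].
(* Oppositeness makes the radical of [X] empty, so optimality says that [X] and its orthogonal span
   everything. *)
have XX : X `&` perp X = set0.
  apply/seteqP; split=> // s [Xs pXs]; have [v sv] := rep_ex (e s).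
  have [n Nn [n' Nn' vE]] := (pts_rep linNN sv).1 (XNN s Xs).
  have sX t : X t -> forall d, rep (e t) d -> orth d v.
    by move=> Xt d td; apply/(orth_collinear orthP td sv); apply: pXs.
  case: Nn vE => [->|[t Nt tn] vE].
    rewrite add0r => vE; rewrite vE in Nn'.
    rewrite -oppN; split; last exact: cone_mem Nn' sv.
    by move=> t Nt; apply: pXs; apply: subset_gen; left.
  suff : (perp N' `&` N) t by rewrite oppN'.
  split=> // r N'r; have [d rd] := rep_ex (e r); apply/(orth_collinear orthP rd tn).
  apply: (linear_subDl (lin d) (u := n')).
    by apply: (orth_cone _ rd Nn') => s'; apply: singular_collinear.
  by rewrite addrC vE; apply: sX rd; apply: subset_gen; right.
rewrite XX image_set0 in genX.
have R0 : rel_perp R set0 = setT by apply/seteqP; split=> // r _ r0 [].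
rewrite {}R0 in genX; move/(PG_gen_setT (@emb_division S e')): genX => spanX.
have [sg [f [_ fE]]] := min_e e'.
have f0 : f 0 = 0 by apply: raddf0.
have fP (a : emb_ring e') (u w : emb_space e') : f (a *: u + w) = sg a *: f u + f w
    by apply: (linearP f).
have f_in t (d : emb_space e') : pg_set (e' t) d -> pg_set (e t) (f d).
  by move=> td; rewrite fE; exists d.
have pull (Q : set V) : linear_sub Q -> linear_sub [set d | Q (f d)].
  move=> linQ; split=> [|a u w Qu Qw] /=; first by rewrite f0; apply: linQ.1.
  by rewrite fP; apply: linQ.2.
(* The points orthogonal to [e' t] include the tangent hyperplane at [t]. If they also included a
   point outside it, they would include some [e' q] with [q] not collinear with [t]. *)
have RT t (p : pt (PG (emb_space e'))) d : R (e' t) p -> rep p d -> tangent t d.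
  move=> tp pd; apply: contrapT => td.
  have [q tq] := exists_far t; have [y qy] := rep_ex (e' q).
  have subY : @subspace (PG (emb_space e')) [set r | R (e' t) r].
    by case: (quasiR (e' t)) => [->|[]//] l ll ? ? ? ? ? ? ?.
  have linY := PG_subspace_linear (@emb_division S e') subY.
  have [k hk] := tangent_complement tq qy d.
  have k0 : k != 0 by apply: contra_notN td => /eqP k0; rewrite k0 scale0r subr0 in hk.
  have tangentY h : tangent t h -> [set w | w != 0 -> exists2 r, R (e' t) r & rep r w] h.
    apply: (lspan_min linY) => w [_ [s ts <-] sw] _; exists (e' s) => //.
    by apply/colR; apply: ts.
  suff Ly : [set w | w != 0 -> exists2 r, R (e' t) r & rep r w] y.
    have [r tr ry] := Ly qy.1.
    by apply: tq; apply/colR; rewrite (rep_inj (@emb_division S e') qy ry).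
  rewrite -(scaleVK (@emb_division S e') y k0); apply: (linear_subZ linY).
  rewrite -(subrK d (k *: y)) -opprB; apply: (linear_subD linY).
    by apply: (linear_subN linY); apply: tangentY.
  by move=> _; exists p.
have tangent_f t d w : rep (e t) w -> tangent (e := e') t d -> orth w (f d).
  move=> tw; apply: (lspan_min (pull _ (lin w))) => h [_ [s ts <-] [_ sh]] /=.
  have {}ts : collinear t s by apply: ts.
  have [z sz] := rep_ex (e s); have := f_in s h sh.
  rewrite (rep_set fieldK sz) => -[a _ <-]; apply: linear_subZ => //.
  by apply/(orth_collinear orthP tw sz).
have Tf d : T (f d).
  apply: (lspan_min (pull _ linT) _ (spanX d)) => w [p [[s Xs <-]|Rp] pw] /=.
    by apply: NNT; apply: (XNN s Xs); apply: f_in; case: pw.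
  exists 0; first exact: linNN.1.
  exists (f w); last by rewrite add0r.
  have half t : X t -> forall u, rep (e t) u -> orth (f w) u.
    move=> Xt u tu; apply: (orth_sym orthP); apply: (tangent_f t) => //.
    by apply: (RT t p) => //; apply: Rp; exists t.
  split=> u [->|[t Nt tu]]; try exact: (lin _).1.
    by apply: (half t) => //; apply: subset_gen; left.
  by apply: (half t) => //; apply: subset_gen; right.
(* The image of [f] contains all singular vectors of [V], and these span [V]. *)
move=> v; apply: (lspan_min linT _ (emb_span_lspan v)) => w [_ [s _ <-] [_]].
by rewrite fE => -[d _ <-].
Qed.

End Orthogonality.

(** Otherwise every point lies in [perp M], hence in [M], and all points are pairwise collinear. *)
Lemma generator_far M : generator M -> perp M `<=` M -> exists m y, M m /\ ~ collinear y m.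
Proof.
move=> [[_ singM] _] perpM; apply: contrapT => no.
have MT y : perp M y.
  move=> m Mm; apply: collinear_sym; apply: contrapT => ym.
  by apply: no; exists m, y.
have [l ll] := exists_line; have [x [_ [_ _]]] := thickS ll.
have [y xy] := exists_far x; apply: xy.
by apply: collinear_sym; apply: (MT x); apply: perpM; apply: MT.
Qed.

End PolarSpaces.

(* The two implications between optimal regularity and complementation *)
Local Close Scope ring_scope.

Theorem theorem3p13 (S : geometry)
  (polarS : polar_space S)
  (nondegS : non_degenerate S)
  (thickS : thick_lined S)
  (rankS : rank_at_least S 2)
  (univS : exists u : embedding S, absolutely_universal u)
  (eps : embedding S)
  (min_eps : minimum_embedding eps) :
  (regular_polar_space S /\
   forall N : set (pt S), sub_generator N -> ~ generator (perp N) ->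
     exists N' : set (pt S),
       [/\ sub_generator N', opposite N N' &
           optimally_embeddable (gen (N `|` N'))])
  <->
  (forall M : set (pt S), generator M ->
     exists M' : set (pt S), complementary eps M M').
Proof.
have [orth orthP] := exists_orthogonality polarS nondegS thickS rankS min_eps.
split=> [[regS optS] M genM|compl].
  have perpM := generator_perp orthP genM.
  have [m [y [Mm ym]]] := generator_far nondegS thickS rankS genM perpM.
  have singM : singular M by case: genM.
  set N := M `&` perp [set y].
  have NM : hyperplane_of N M by apply: hyperplane_perp Mm ym.
  have subN : sub_generator N.
    by split; [case: NM => sN [NsM _] _; apply: singular_sub singM sN NsM | exists M].
  (* Were [perp N] a generator, it would equal [M], which it contains; but [y] belongs to
     [perp N]. *)
  have ngN : ~ generator (perp N).
    move=> [singP _]; have [_ maxM] := genM.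
    have MN : M `<=` perp N by move=> s Ms t [Mt _]; apply: (singular_collinear singM).
    have My : M y.
      by rewrite -(maxM _ singP MN) => t [_ yt]; apply: collinear_sym; apply: yt.
    by apply: ym; apply: (singular_collinear singM).
  have [N' [[singN' _] oppN optN]] := optS N subN ngN.
  have [//|[a [b [Na Nb ab perpNE]]]] := regS N subN.
  have decN :=
    optimally_embeddable_decomp polarS nondegS thickS rankS orthP min_eps subN.1 singN' oppN optN.
  exact: (perp_minimal_complement polarS nondegS thickS rankS orthP genM NM
     singN' oppN decN Na Nb ab perpNE).
(* A complement of a generator through [N] serves for both conditions. *)
split=> [N [singN [M genM NM]]|N [singN [M genM NM]] ngN]; have [M' cMM] := compl M genM.
  have [|ngN] := EM (generator (perp N)); first by left.
  have [x [y [Mx Nx My Ny xy]]] := sub_generator_pair orthP cMM NM ngN.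
  right; exists x, y; split=> //.
    move=> t Nt; have [_ [NsM _] _] := NM.
    by apply: (singular_collinear (X := M)) => //; [case: genM | apply: NsM].
  exact: (sub_generator_perp polarS orthP cMM NM Mx Nx My Ny xy).
have [x [y [Mx Nx My Ny xy]]] := sub_generator_pair orthP cMM NM ngN.
exists (M' `&` perp [set x]); split.
- exact: (complement_sub_generator polarS thickS cMM My xy).
- exact: (complement_opposite polarS thickS orthP cMM NM Mx Nx My Ny xy).
exact: (complement_optimally_embeddable polarS thickS orthP cMM NM Mx Nx My Ny xy).
Qed.
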